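(* Let $(M_n)$ be a non-analytic weight sequence and let $\phi$ be a map from $[0,1]$ to $[0,1]$. If $\phi$ induces an endomorphism of $D([0,1],M)$, then $\|\phi'\|_\infty\le 1$.
   Context: A weight sequence is a sequence $(M_n)_{n\ge 0}$ of positive real numbers with $M_0=1$ and $\frac{M_{n+m}}{M_nM_m}\ge\binom{n+m}{m}$ for all non-negative integers $m,n$. It is non-analytic if $\lim_{n\to\infty}(n!/M_n)^{1/n}=0$. $D([0,1],M)$ is the set of complex-valued infinitely differentiable functions $f$ on $[0,1]$ (one-sided derivatives at endpoints) with $\|f\|_D=\sum_{n=0}^\infty \frac{\|f^{(n)}\|_\infty}{M_n}<\infty$, where $\|\cdot\|_\infty$ is the supremum norm on $[0,1]$; with pointwise operations and the norm $\|\cdot\|_D$ it is a unital commutative semisimple Banach algebra. A map $\phi:[0,1]\to[0,1]$ induces an endomorphism of $D([0,1],M)$ if $f\circ\phi\in D([0,1],M)$ for every $f\in D([0,1],M)$. Since $f(x)=x$ lies in $D([0,1],M)$, such a $\phi$ automatically lies in $D([0,1],M)$, so $\phi'$ makes sense. *)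

(* Defs.v *)
From Stdlib Require Import Reals.
From Coquelicot Require Import Coquelicot.

Open Scope R_scope.

Definition weight_sequence (M : nat -> R) : Prop :=
  (forall n, 0 < M n) /\
  M 0%nat = 1 /\
  (forall m n : nat, M (n + m)%nat / (M n * M m) >= Binomial.C (n + m) m).

(* The term n = 0, where the exponent [/ INR 0] is meaningless, does not
   affect the limit. *)
Definition nonanalytic (M : nat -> R) : Prop :=
  is_lim_seq (fun n => Rpower (INR (Factorial.fact n) / M n) (/ INR n)) 0.

(* Functions on [0,1] are represented by functions on R, of which only the
   values on [0,1] are ever used. *)
Definition I01 (x : R) : Prop := 0 <= x <= 1.

Definition supnorm01 (f : R -> C) : Rbar :=
  Lub_Rbar (fun r => exists x, I01 x /\ r = Cmod (f x)).

(* Same as [forall x, I01 x -> is_derive f x (df x)] except that increments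
   are taken inside [0,1], hence one-sided derivatives at 0 and 1. *)
Definition is_derive01 (f df : R -> C) : Prop :=
  forall x, I01 x ->
    @filterdiff R_AbsRing R_NormedModule C_R_NormedModule
      f (within I01 (locally x)) (fun h : R => scal h (df x)).

Definition iterated_derivatives01 (f : R -> C) (g : nat -> R -> C) : Prop :=
  (forall x, I01 x -> g 0%nat x = f x) /\
  (forall n, is_derive01 (g n) (g (S n))).

(* The projection [real] loses nothing: each [g n] is differentiable, hence
   continuous and bounded, on [0,1]. *)
Definition in_D (M : nat -> R) (f : R -> C) : Prop :=
  exists g : nat -> R -> C,
    iterated_derivatives01 f g /\
    ex_series (fun n => real (supnorm01 (g n)) / M n).

Definition maps_I01 (phi : R -> R) : Prop :=
  forall x, I01 x -> I01 (phi x).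

Definition induces_endomorphism (M : nat -> R) (phi : R -> R) : Prop :=
  forall f : R -> C, in_D M f -> in_D M (fun x => f (phi x)).

(* Main.v *)
(* Suppose |phi'| >= c > 1 on some interval [a, b].  On [a, b] the function
   cos (l * phi x) oscillates with frequency at least c * l, and a
   Landau-Kolmogorov inequality (comparison with splines by counting zeros)
   shows that its n-th derivative has size at least (c' * l)^n / 2, with
   1 < c' < c, for all n <= eps * l.  Because M is non-analytic, only these n
   matter in the size max_n l^n / M_n of cos (l * y) in D, and this maximal term
   grows faster than polynomially; hence (c' * l)^n / M_n is unboundedly larger
   than max_m (d * l)^m / M_m, 1 < d < c', for suitable l and n <= eps * l.
   A lacunary series of cosines then lies in D while its composition with phi
   does not.  Since the inequality only uses the values of a function, no
   continuity of the endomorphism f |-> f o phi is needed. *)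

(* Since [c] may be arbitrarily close to 1, the derivative inequality may lose a fixed factor but
   nothing exponential in n. Hence comparison functions bounded by 1 for every [m], whose [m]-th
   derivative still has slopes of size at least 1/2. Zeros pay for derivatives: each use of Rolle
   costs one, and the surplus of oscillations of the cosine over the spline is proportional to l,
   which is why n is limited to [eps * l]. Around the k-th cosine of the series the other terms are
   treated asymmetrically. The earlier ones, composed with [phi], lie in D one by one; their bound
   is uncontrolled but known before the k-th frequency is chosen, so their sum can be subtracted.
   The later ones only have to be small in supremum norm, whatever their derivatives are. *)
Require Import Defs.
From Stdlib Require Import Reals Lra Lia ClassicalEpsilon IndefiniteDescription.
From Coquelicot Require Import Coquelicot.

Open Scope R_scope.

(** * Bounded periodic splines *)

(* The bound by [sin], and not only by 1, is what [spline_step] preserves: plain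
   integration of |f| <= 1 would lose a factor pi/2 at each step. *)
Definition spline_bound (f : R -> R) : Prop :=
  (forall x, continuous f x) /\
  (forall x, f (- x) = - f x) /\
  (forall x, f (x + PI) = - f x) /\
  (forall x, Rabs (f x) <= Rabs (sin x)).

Lemma is_derive_zero_const (f : R -> R) :
  (forall x, is_derive f x 0) -> forall x y, f x = f y.
Proof.
  intros Hf x y.
  destruct (MVT_gen f x y (fun _ => 0)) as [c [_ Hc]].
  - intros z _; apply Hf.
  - intros z _; apply derivable_continuous_pt.
    exists 0; apply is_derive_Reals, Hf.
  - lra.
Qed.

Lemma is_derive_increasing (f df : R -> R) (a b : R) :
  a <= b ->
  (forall x, a <= x <= b -> is_derive f x (df x)) ->
  (forall x, a <= x <= b -> 0 <= df x) -> f a <= f b.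
Proof.
  intros Hab Hd Hp.
  destruct (MVT_gen f a b df) as [c [Hc Heq]];
    rewrite ?Rmin_left, ?Rmax_right in * by lra.
  - intros z Hz; apply Hd; lra.
  - intros z Hz; apply derivable_continuous_pt.
    exists (df z); apply is_derive_Reals, Hd; lra.
  - specialize (Hp c Hc); nra.
Qed.

Lemma antiperiodic_reduction (P : R -> Prop) :
  (forall x, P x <-> P (x + PI)) ->
  (forall x, - (PI / 2) <= x <= PI / 2 -> P x) ->
  forall x, P x.
Proof.
  intros Hper Hbase.
  assert (Hpos : forall (n : nat) x,
             - (PI / 2) <= x <= PI / 2 + INR n * PI -> P x).
  { induction n as [|n IH]; intros x Hx.
    - apply Hbase; simpl in Hx; lra.
    - destruct (Rle_dec x (PI / 2)) as [H|H]; [apply Hbase; lra|].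
      replace x with (x - PI + PI) by ring.
      apply (proj1 (Hper _)), IH; rewrite S_INR in Hx; lra. }
  assert (Hall : forall (m n : nat) x,
             - (PI / 2) - INR m * PI <= x <= PI / 2 + INR n * PI -> P x).
  { induction m as [|m IH]; intros n x Hx.
    - apply (Hpos n); simpl in Hx; lra.
    - apply (proj2 (Hper _)), (IH (S n)).
      rewrite S_INR in Hx |- *; lra. }
  intros x.
  assert (HP := PI_RGT_0).
  destruct (nfloor_ex (Rabs x / PI)) as [n Hn].
  { apply Rdiv_le_0_compat; [apply Rabs_pos | lra]. }
  apply (Hall (S n) (S n)).
  assert (Rabs x <= INR (S n) * PI).
  { apply Rle_div_l; [lra|]; rewrite S_INR; lra. }
  assert (Hx := Rabs_le_between' x 0 (INR (S n) * PI)).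
  rewrite Rminus_0_r in Hx; apply Hx in H; lra.
Qed.

(** The shift makes [sin] a fixed point, because the derivative of [sin] is [sin] shifted by
    [PI / 2]. *)
Definition spline_step (f : R -> R) (x : R) : R :=
  RInt (fun t => f (t + PI / 2)) 0 x.

Lemma spline_step_derive (f : R -> R) :
  (forall x, continuous f x) ->
  forall x, is_derive (spline_step f) x (f (x + PI / 2)).
Proof.
  intros Hf x.
  assert (Hc : forall y, continuous (fun t => f (t + PI / 2)) y).
  { intros y; apply (continuous_comp (fun t => t + PI / 2) f); [|apply Hf].
    apply (continuous_plus (V := R_NormedModule));
      [apply continuous_id | apply continuous_const]. }
  apply (is_derive_RInt (fun t => f (t + PI / 2)) (spline_step f) 0); [|apply Hc].
  apply filter_forall; intros y.
  apply (RInt_correct (V := R_CompleteNormedModule) (fun t => f (t + PI / 2))), (ex_RInt_continuous (V := R_CompleteNormedModule)).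
  intros; apply Hc.
Qed.

Lemma sin_antiperiodic (x : R) : sin (x + PI) = - sin x.
Proof. rewrite sin_plus, cos_PI, sin_PI; ring. Qed.

Lemma cos_antiperiodic (x : R) : cos (x + PI) = - cos x.
Proof. rewrite cos_plus, cos_PI, sin_PI; ring. Qed.

(** On [0, PI/2] the integrand is at most [cos] in absolute value, and [cos] integrates to [sin];
    oddness and antiperiodicity, inherited by the integral, carry the bound to the whole line. *)
Lemma spline_step_bound (f : R -> R) :
  spline_bound f -> spline_bound (spline_step f).
Proof.
  intros (Hc & Ho & Hp & Hb).
  assert (Hd := spline_step_derive f Hc).
  assert (H0 : spline_step f 0 = 0) by apply (RInt_point (V := R_CompleteNormedModule) 0).
  assert (Hodd : forall x, spline_step f (- x) = - spline_step f x).
  { intros x.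
    enough (spline_step f (- x) + spline_step f x
            = spline_step f (- 0) + spline_step f 0)
      by (rewrite Ropp_0, H0 in H; lra).
    apply (is_derive_zero_const
             (fun x => spline_step f (- x) + spline_step f x)).
    intros y.
    replace 0 with (plus (scal (-1) (f (- y + PI / 2))) (f (y + PI / 2))).
    - apply (is_derive_plus (K := R_AbsRing) (V := R_NormedModule)).
      + apply (is_derive_comp (K := R_AbsRing) (V := R_NormedModule)).
        * apply Hd.
        * auto_derive; [easy | ring].
      + apply Hd.
    - change (-1 * f (- y + PI / 2) + f (y + PI / 2) = 0).
      replace (y + PI / 2) with (- (- y + PI / 2) + PI) by field.
      rewrite Hp, Ho; ring. }
  assert (Hanti : forall x, spline_step f (x + PI) = - spline_step f x).
  { intros x.
    (* The sum is constant in [x], and at [- (PI / 2)] oddness makes it vanish. *)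
    enough (spline_step f (x + PI) + spline_step f x
            = spline_step f (- (PI / 2) + PI) + spline_step f (- (PI / 2))).
    { replace (- (PI / 2) + PI) with (PI / 2) in H by field.
      rewrite Hodd in H; lra. }
    apply (is_derive_zero_const
             (fun x => spline_step f (x + PI) + spline_step f x)).
    intros y.
    replace 0 with (plus (scal 1 (f (y + PI + PI / 2))) (f (y + PI / 2))).
    - apply (is_derive_plus (K := R_AbsRing) (V := R_NormedModule)).
      + apply (is_derive_comp (K := R_AbsRing) (V := R_NormedModule)).
        * apply Hd.
        * auto_derive; [easy | ring].
      + apply Hd.
    - change (1 * f (y + PI + PI / 2) + f (y + PI / 2) = 0).
      replace (y + PI + PI / 2) with (y + PI / 2 + PI) by ring.
      rewrite Hp; ring. }
  assert (Hsin : forall x, sin (x + PI / 2) = cos x).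
  { intros x; rewrite sin_plus, cos_PI2, sin_PI2; ring. }
  assert (Hhalf : forall x, 0 <= x <= PI / 2 ->
             Rabs (spline_step f x) <= Rabs (sin x)).
  { intros x Hx.
    assert (Hcos : forall t, 0 <= t <= x -> Rabs (f (t + PI / 2)) <= cos t).
    { intros t Ht; rewrite <- (Rabs_pos_eq (cos t)), <- Hsin;
        [apply Hb | apply cos_ge_0; lra]. }
    rewrite (Rabs_pos_eq (sin x)) by (apply sin_ge_0; lra).
    apply Rabs_le; split.
    - enough (sin 0 + spline_step f 0 <= sin x + spline_step f x)
        by (rewrite sin_0, H0 in H; lra).
      apply (is_derive_increasing (fun x => sin x + spline_step f x)
               (fun x => plus (cos x) (f (x + PI / 2)))); [lra| |].
      + intros t _.
        apply (is_derive_plus (K := R_AbsRing) (V := R_NormedModule));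
          [apply is_derive_Reals, derivable_pt_lim_sin | apply Hd].
      + intros t Ht; specialize (Hcos t Ht).
        change (0 <= cos t + f (t + PI / 2)).
        apply Rabs_le_between in Hcos; lra.
    - enough (sin 0 - spline_step f 0 <= sin x - spline_step f x)
        by (rewrite sin_0, H0 in H; lra).
      apply (is_derive_increasing (fun x => sin x - spline_step f x)
               (fun x => minus (cos x) (f (x + PI / 2)))); [lra| |].
      + intros t _.
        apply (is_derive_minus (K := R_AbsRing) (V := R_NormedModule));
          [apply is_derive_Reals, derivable_pt_lim_sin | apply Hd].
      + intros t Ht; specialize (Hcos t Ht).
        change (0 <= cos t - f (t + PI / 2)).
        apply Rabs_le_between in Hcos; lra. }
  repeat split; auto.
  - intros x; apply (ex_derive_continuous (V := R_NormedModule)).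
    exists (f (x + PI / 2)); apply Hd.
  - apply antiperiodic_reduction.
    + intros x; rewrite Hanti, sin_antiperiodic, !Rabs_Ropp; tauto.
    + intros x Hx; destruct (Rle_dec 0 x) as [H|H]; [apply Hhalf; lra|].
      rewrite <- (Rabs_Ropp (spline_step f x)), <- (Rabs_Ropp (sin x)),
        <- Hodd, <- sin_neg.
      apply Hhalf; lra.
Qed.

(* Plays the role of a triangle wave: continuous, with slope at least 1 in
   absolute value between its consecutive cusps. *)
Definition cusp (y : R) : R := Rabs (sin y) - Rabs (cos y).

(** Halving the argument turns the antiperiod [PI / 2] of [cusp] into [PI] and halves the slope; the
    shift by [PI / 4] moves a zero to the origin. The family imitates the Euler splines, extremal in
    Kolmogorov's inequality. *)
Fixpoint spline (m : nat) : R -> R :=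
  match m with
  | O => fun x => cusp (x / 2 + PI / 4)
  | S m => spline_step (spline m)
  end.

Lemma cusp_antiperiodic (y : R) : cusp (y + PI / 2) = - cusp y.
Proof.
  unfold cusp.
  rewrite sin_plus, cos_plus, cos_PI2, sin_PI2.
  replace (sin y * 0 + cos y * 1) with (cos y) by ring.
  replace (cos y * 0 - sin y * 1) with (- sin y) by ring.
  rewrite Rabs_Ropp; ring.
Qed.

Lemma cusp_odd (x : R) : cusp (- x + PI / 4) = - cusp (x + PI / 4).
Proof.
  unfold cusp.
  replace (- x + PI / 4) with (PI / 2 - (x + PI / 4)) by field.
  rewrite sin_shift, cos_shift; ring.
Qed.

(** The difference of squares in [cos (2 * y)] factors, and the cofactor of [cusp y], a sum of
    absolute values of sine and cosine, is at least 1. *)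
Lemma cusp_bound (y : R) : Rabs (cusp y) <= Rabs (cos (2 * y)).
Proof.
  assert (H : cos (2 * y) = - (cusp y * (Rabs (sin y) + Rabs (cos y)))).
  { rewrite cos_2a; unfold cusp.
    rewrite <- (Rabs_pos_eq (cos y * cos y)), <- (Rabs_pos_eq (sin y * sin y))
      by nra.
    rewrite !Rabs_mult; ring. }
  rewrite H, Rabs_Ropp, Rabs_mult.
  assert (Hs := Rabs_pos (sin y)); assert (Hc := Rabs_pos (cos y)).
  rewrite (Rabs_pos_eq (_ + _)) by lra.
  assert (1 <= Rabs (sin y) + Rabs (cos y)).
  { assert (H2 := sin2_cos2 y).
    rewrite (Rsqr_abs (sin y)), (Rsqr_abs (cos y)) in H2; unfold Rsqr in H2.
    nra. }
  assert (H3 := Rabs_pos (cusp y)); nra.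
Qed.

Lemma spline_spec (m : nat) : spline_bound (spline m).
Proof.
  induction m as [|m IH]; [|apply spline_step_bound, IH].
  repeat split.
  - intros x; simpl; unfold cusp.
    apply (continuous_minus (V := R_NormedModule));
      apply (continuous_comp _ Rabs); try apply continuous_Rabs;
      apply (ex_derive_continuous (V := R_NormedModule)); auto_derive; easy.
  - intros x; simpl.
    replace (- x / 2) with (- (x / 2)) by field; apply cusp_odd.
  - intros x; simpl.
    replace ((x + PI) / 2 + PI / 4) with (x / 2 + PI / 4 + PI / 2) by field.
    apply cusp_antiperiodic.
  - intros x; simpl.
    replace (sin x) with (- cos (2 * (x / 2 + PI / 4))).
    + rewrite Rabs_Ropp; apply cusp_bound.
    + replace (2 * (x / 2 + PI / 4)) with (x + PI / 2) by field.
      rewrite cos_plus, cos_PI2, sin_PI2; ring.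
Qed.

(** In the first quadrant [cusp] is sin - cos, with derivative cos + sin at least 1; antiperiodicity
    moves every other quadrant there. *)
Lemma cusp_expanding (k : nat) (y z : R) :
  INR k * (PI / 2) <= y -> y <= z -> z <= (INR k + 1) * (PI / 2) ->
  z - y <= Rabs (cusp z - cusp y).
Proof.
  revert y z; induction k as [|k IH]; intros y z Hy Hyz Hz.
  - simpl in Hy, Hz; unfold cusp.
    rewrite !(Rabs_pos_eq (sin _)) by (apply sin_ge_0; lra).
    rewrite !(Rabs_pos_eq (cos _)) by (apply cos_ge_0; lra).
    eapply Rle_trans; [|apply Rle_abs].
    enough (sin y - cos y - y <= sin z - cos z - z) by lra.
    apply (is_derive_increasing (fun x => sin x - cos x - x)
             (fun x => cos x + sin x - 1)); [easy| |].
    + intros x _; auto_derive; [easy | ring].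
    + intros x Hx.
      assert (H2 := sin2_cos2 x); unfold Rsqr in H2.
      assert (0 <= sin x) by (apply sin_ge_0; lra).
      assert (0 <= cos x) by (apply cos_ge_0; lra).
      nra.
  - rewrite S_INR in Hy, Hz.
    assert (H := IH (y - PI / 2) (z - PI / 2)).
    replace y with (y - PI / 2 + PI / 2) at 2 by ring.
    replace z with (z - PI / 2 + PI / 2) at 2 by ring.
    rewrite !cusp_antiperiodic, <- Rabs_Ropp.
    replace (- (- cusp (z - PI / 2) - - cusp (y - PI / 2)))
      with (cusp (z - PI / 2) - cusp (y - PI / 2)) by ring.
    lra.
Qed.

Lemma spline_derive (m : nat) (x : R) :
  is_derive (spline (S m)) x (spline m (x + PI / 2)).
Proof. apply spline_step_derive, spline_spec. Qed.

Lemma spline_le_1 (m : nat) (x : R) : Rabs (spline m x) <= 1.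
Proof.
  eapply Rle_trans; [apply spline_spec|].
  apply Rabs_le, SIN_bound.
Qed.

(** * A Landau-Kolmogorov inequality *)

Definition increasing_points (a b : R) (N : nat) (z : nat -> R) : Prop :=
  (forall i, (i < N)%nat -> a <= z i <= b) /\
  (forall i, (S i < N)%nat -> z i < z (S i)).

Definition has_zeros (f : R -> R) (a b : R) (N : nat) : Prop :=
  exists z, increasing_points a b N z /\ forall i, (i < N)%nat -> f (z i) = 0.

(** Common core of the Rolle and intermediate value arguments: points picked in successive open gaps
    increase automatically. *)
Lemma interlacing_points (a b : R) (N : nat) (z : nat -> R) (P : R -> Prop) :
  increasing_points a b (S N) z ->
  (forall i, (i < N)%nat -> exists x, z i < x < z (S i) /\ P x) ->
  exists x, increasing_points a b N x /\ forall i, (i < N)%nat -> P (x i).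
Proof.
  intros [Hz Hlt] H.
  destruct (functional_choice (fun i x => (i < N)%nat -> z i < x < z (S i) /\ P x))
    as [x Hx].
  { intros i; destruct (Compare_dec.lt_dec i N) as [Hi|Hi].
    - destruct (H i Hi) as [x Hx]; exists x; auto.
    - exists 0; lia. }
  exists x; split; [split|].
  - intros i Hi; destruct (Hx i Hi) as [Hxi _].
    assert (H1 := Hz i ltac:(lia)); assert (H2 := Hz (S i) ltac:(lia)); lra.
  - intros i Hi.
    destruct (Hx i ltac:(lia)) as [H1 _]; destruct (Hx (S i) Hi) as [H2 _]; lra.
  - intros i Hi; apply (Hx i Hi).
Qed.

Lemma Rolle_zeros (f df : R -> R) (a b : R) (N : nat) :
  (forall x, a <= x <= b -> is_derive f x (df x)) ->
  has_zeros f a b (S N) -> has_zeros df a b N.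
Proof.
  intros Hd (z & Hz & H0).
  apply (interlacing_points a b N z (fun x => df x = 0) Hz).
  intros i Hi; destruct Hz as [Hz Hlt].
  assert (Hzi := Hlt i ltac:(lia)).
  assert (H1 := Hz i ltac:(lia)); assert (H2 := Hz (S i) ltac:(lia)).
  destruct (MVT_cor2 f df (z i) (z (S i)) Hzi) as [c [Hc Hc']].
  - intros c Hc; apply is_derive_Reals, Hd; lra.
  - exists c; split; [exact Hc'|].
    rewrite (H0 i), (H0 (S i)) in Hc by lia; nra.
Qed.

Lemma is_derive_continuity_pt (f : R -> R) (x l : R) :
  is_derive f x l -> continuity_pt f x.
Proof.
  intros H; apply derivable_continuous_pt; exists l; apply is_derive_Reals, H.
Qed.

Lemma sign_changes_zeros (f : R -> R) (a b : R) (N s : nat) (y : nat -> R) :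
  (forall x, a <= x <= b -> continuity_pt f x) ->
  increasing_points a b (S N) y ->
  (forall i, (i <= N)%nat -> 0 < (-1) ^ (i + s) * f (y i)) ->
  has_zeros f a b N.
Proof.
  intros Hc Hy Hs.
  apply (interlacing_points a b N y (fun x => f x = 0) Hy).
  intros i Hi; destruct Hy as [Hy Hlt].
  assert (Hyi := Hlt i ltac:(lia)).
  assert (H1 := Hy i ltac:(lia)); assert (H2 := Hy (S i) ltac:(lia)).
  assert (S1 := Hs i ltac:(lia)); assert (S2 := Hs (S i) ltac:(lia)).
  simpl in S2.
  destruct (Ranalysis5.IVT_interv (fun x => - (-1) ^ (i + s) * f x) (y i) (y (S i)))
    as [c [Hc1 Hc2]].
  - intros x Hx; apply (continuity_pt_scal f), Hc; lra.
  - exact Hyi.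
  - lra.
  - lra.
  - assert (E : f c = 0).
    { apply Rmult_integral in Hc2; destruct Hc2 as [Hc2|Hc2]; [|exact Hc2].
      nra. }
    exists c; split; [|exact E].
    destruct (Req_dec c (y i)) as [->|]; [rewrite E in S1; lra|].
    destruct (Req_dec c (y (S i))) as [->|]; [rewrite E in S2; lra|].
    lra.
Qed.

(* A Landau-Kolmogorov inequality: [v 0] oscillates faster than
   [A * spline m (mu * x)], so their difference has many zeros; by Rolle so has
   its [m]-th derivative, which is strictly monotone between consecutive cusps
   of the spline as soon as [v (S m)] is smaller than the slope there. *)
Lemma oscillation_derivative_bound
  (v : nat -> R -> R) (a b mu A : R) (m N s : nat) (y : nat -> R) :
  (forall i x, a <= x <= b -> is_derive (v i) x (v (S i) x)) ->
  0 <= a -> 0 < mu -> 0 < A ->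
  increasing_points a b (S N) y ->
  (forall i, (i <= N)%nat -> A < (-1) ^ (i + s) * v 0%nat (y i)) ->
  mu * (b - a) / PI + INR m + 2 <= INR N ->
  exists x, a <= x <= b /\ A / 2 * mu ^ S m <= Rabs (v (S m) x).
Proof.
  intros Hv Ha Hmu HA Hy Hs HN.
  assert (HP := PI_RGT_0).
  apply NNPP; intros Hno.
  assert (Hsmall : forall x, a <= x <= b -> Rabs (v (S m) x) < A / 2 * mu ^ S m).
  { intros x Hx; apply Rnot_le_lt; intros H; apply Hno; exists x; auto. }
  assert (Hab : a <= b).
  { destruct Hy as [Hy _]; specialize (Hy 0%nat ltac:(lia)); lra. }
  assert (HmN : (m + 2 <= N)%nat).
  { apply INR_le; rewrite plus_INR; simpl (INR 2).
    assert (0 <= mu * (b - a) / PI)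
      by (apply Rdiv_le_0_compat; [apply Rmult_le_pos|]; lra).
    lra. }
  (* For [i <= m] this is the [i]-th derivative of [A * spline m (mu * x)]: each derivative lowers
     the index and shifts the phase. *)
  set (w := fun i x => A * mu ^ i * spline (m - i) (mu * x + INR i * (PI / 2))).
  assert (Hw : forall i x, (i < m)%nat -> is_derive (w i) x (w (S i) x)).
  { intros i x Hi; unfold w.
    replace (m - i)%nat with (S (m - S i)) by lia.
    set (g := spline (S (m - S i))).
    assert (Hg : is_derive g (mu * x + INR i * (PI / 2))
                   (spline (m - S i) (mu * x + INR (S i) * (PI / 2)))).
    { rewrite S_INR.
      replace (mu * x + (INR i + 1) * (PI / 2))
        with (mu * x + INR i * (PI / 2) + PI / 2) by ring.
      apply spline_derive. }
    auto_derive.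
    - eexists; exact Hg.
    - rewrite (is_derive_unique (fun x : R => g x) _ _ Hg : Derive (fun x : R => g x) _ = _); simpl; ring. }
  assert (Hzeros : forall i, (i <= m)%nat ->
            has_zeros (fun x => v i x - w i x) a b (N - i)).
  { induction i as [|i IH]; intros Hi.
    - replace (N - 0)%nat with N by lia.
      apply (sign_changes_zeros _ a b N s y); [| exact Hy |].
      + intros x Hx; apply continuity_pt_minus.
        * eapply is_derive_continuity_pt, Hv, Hx.
        * unfold w; apply continuity_pt_filterlim.
          apply (continuous_scal_r (K := R_AbsRing) (V := R_NormedModule)
                   (A * mu ^ 0)
                   (fun x => spline (m - 0) (mu * x + INR 0 * (PI / 2)))).
          apply (continuous_comp (fun x => mu * x + INR 0 * (PI / 2))
                   (spline (m - 0))); [|apply spline_spec].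
          apply (ex_derive_continuous (V := R_NormedModule));
            auto_derive; easy.
      + intros i Hi'; specialize (Hs i Hi').
        (* As [A] bounds the scaled spline, subtracting it cannot change the sign of [v 0] at
           [y i]. *)
        assert (Hb : Rabs (w 0%nat (y i)) <= A).
        { unfold w; rewrite Rabs_mult, pow_O, Rmult_1_r, Rabs_pos_eq by lra.
          assert (Hle := spline_le_1 (m - 0) (mu * y i + INR 0 * (PI / 2))).
          nra. }
        assert (Hsgn := pow_1_abs (i + s)).
        assert (Habs : Rabs ((-1) ^ (i + s) * w 0%nat (y i)) <= A)
          by (rewrite Rabs_mult, Hsgn; lra).
        apply Rabs_le_between in Habs.
        rewrite Rmult_minus_distr_l; lra.
    - apply (Rolle_zeros (fun x => v i x - w i x)).
      + intros x Hx.
        apply (is_derive_minus (K := R_AbsRing) (V := R_NormedModule));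
          [apply Hv, Hx | apply Hw; lia].
      + replace (S (N - S i)) with (N - i)%nat by lia; apply IH; lia. }
  destruct (Hzeros m (Nat.le_refl m)) as (z & [Hz Hlt] & H0).
  (* [tau] measures position in units of the pieces of [w m]: the cusps are where it is an
     integer. *)
  set (tau := fun x => (mu * x + INR m * (PI / 2)) / PI + / 2).
  assert (Hcusp : forall x, w m x = A * mu ^ m * cusp (tau x * (PI / 2))).
  { intros x; unfold w, tau; replace (m - m)%nat with 0%nat by lia.
    simpl; f_equal; f_equal; field; lra. }
  assert (Hdiff : forall x x', tau x' - tau x = mu * (x' - x) / PI)
    by (intros x x'; unfold tau; field; lra).
  destruct (nfloor_ex (tau (z 0%nat))) as [k Hk].
  { specialize (Hz 0%nat ltac:(lia)).
    apply Rplus_le_le_0_compat; [|lra].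
    apply Rdiv_le_0_compat; [|exact HP].
    assert (Hm := pos_INR m).
    apply Rplus_le_le_0_compat; apply Rmult_le_pos; lra. }
  (* No piece holds two zeros of [v m - w m]: between them [w m] would change by at least
     [A * mu ^ m * (mu / 2)] times their distance, and [v m] by less. So each further zero lies
     beyond one more cusp. *)
  assert (Hstep : forall i, (i < N - m)%nat -> INR k + INR i <= tau (z i)).
  { induction i as [|i IH]; intros Hi.
    - simpl (INR 0); lra.
    - specialize (IH ltac:(lia)).
      rewrite S_INR; apply Rnot_lt_le; intros Hlow.
      assert (Hzz := Hlt i Hi).
      assert (Z1 := Hz i ltac:(lia)); assert (Z2 := Hz (S i) Hi).
      assert (Htau : tau (z i) <= tau (z (S i))).
      { enough (0 <= tau (z (S i)) - tau (z i)) by lra.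
        rewrite Hdiff; apply Rdiv_le_0_compat; [apply Rmult_le_pos|]; lra. }
      assert (Hexp := cusp_expanding (k + i) (tau (z i) * (PI / 2))
                        (tau (z (S i)) * (PI / 2))).
      rewrite plus_INR in Hexp.
      assert (Hex : mu / 2 * (z (S i) - z i)
                    <= Rabs (cusp (tau (z (S i)) * (PI / 2))
                             - cusp (tau (z i) * (PI / 2)))).
      { replace (mu / 2 * (z (S i) - z i))
          with (tau (z (S i)) * (PI / 2) - tau (z i) * (PI / 2)).
        - apply Hexp; nra.
        - rewrite <- Rmult_minus_distr_r, Hdiff; field; lra. }
      destruct (MVT_cor2 (v m) (v (S m)) (z i) (z (S i)) Hzz) as [c [Hc Hc']].
      { intros c Hc; apply is_derive_Reals, Hv; lra. }
      assert (E1 := H0 i ltac:(lia)); assert (E2 := H0 (S i) Hi).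
      cbv beta in E1, E2; rewrite Hcusp in E1, E2.
      assert (E : A * mu ^ m * (cusp (tau (z (S i)) * (PI / 2))
                                - cusp (tau (z i) * (PI / 2)))
                  = v (S m) c * (z (S i) - z i)) by lra.
      apply (f_equal Rabs) in E.
      assert (Hmm : 0 < mu ^ m) by (apply pow_lt; lra).
      rewrite !Rabs_mult, (Rabs_pos_eq A), (Rabs_pos_eq (mu ^ m)),
        (Rabs_pos_eq (z (S i) - z i)) in E by lra.
      assert (Hc2 := Hsmall c ltac:(lra)); simpl in Hc2.
      assert (A * mu ^ m * (mu / 2 * (z (S i) - z i))
              <= Rabs (v (S m) c) * (z (S i) - z i)).
      { rewrite <- E; apply Rmult_le_compat_l; [|exact Hex].
        apply Rmult_le_pos; lra. }
      nra. }
  (* Source of the [+ 2]: [N - m] zeros make only [N - m - 1] steps, and the floor at the first zero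
     costs up to one more. *)
  specialize (Hstep (N - m - 1)%nat ltac:(lia)).
  assert (Hend : tau (z (N - m - 1)%nat) - tau (z 0%nat) <= mu * (b - a) / PI).
  { rewrite Hdiff.
    assert (Z1 := Hz 0%nat ltac:(lia)).
    assert (Z2 := Hz (N - m - 1)%nat ltac:(lia)).
    apply Rmult_le_compat_r; [left; apply Rinv_0_lt_compat, HP|].
    apply Rmult_le_compat_l; lra. }
  rewrite !minus_INR in Hstep by lia; simpl (INR 1) in Hstep.
  lra.
Qed.

(** * Maximal terms *)

Lemma nonanalytic_growth (M : nat -> R) (eta : R) :
  weight_sequence M -> nonanalytic M -> 0 < eta ->
  exists n0, forall n, (n0 <= n)%nat -> INR (Factorial.fact n) <= eta ^ n * M n.
Proof.
  intros [Hpos _] Hna Heta.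
  apply is_lim_seq_spec in Hna.
  destruct (Hna (mkposreal eta Heta)) as [n0 Hn0]; simpl in Hn0.
  (* The successor excludes [n = 0], where [/ INR n] inverts nothing. *)
  exists (S n0); intros n Hn.
  specialize (Hn0 n ltac:(lia)); rewrite Rminus_0_r in Hn0.
  set (q := INR (Factorial.fact n) / M n) in *.
  assert (Hq : 0 < q)
    by (apply Rdiv_lt_0_compat; [apply INR_fact_lt_0 | apply Hpos]).
  assert (Hr : 0 < Rpower q (/ INR n)) by apply exp_pos.
  rewrite Rabs_pos_eq in Hn0 by lra.
  assert (Hn' : INR n <> 0) by (apply not_0_INR; lia).
  assert (E : Rpower q (/ INR n) ^ n = q).
  { rewrite <- Rpower_pow, Rpower_mult, Rinv_l, Rpower_1; auto. }
  assert (Hqe : q <= eta ^ n) by (rewrite <- E; apply pow_incr; lra).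
  unfold q in Hqe; apply Rle_div_l in Hqe; [exact Hqe | apply Hpos].
Qed.

Lemma max_exists (u : nat -> R) (n0 : nat) :
  exists p, forall n, (n <= n0)%nat -> u n <= u p.
Proof.
  induction n0 as [|n0 [p Hp]].
  - exists 0%nat; intros n Hn; replace n with 0%nat by lia; lra.
  - destruct (Rle_dec (u (S n0)) (u p)) as [H|H].
    + exists p; intros n Hn.
      destruct (Nat.eq_dec n (S n0)) as [->|]; [exact H | apply Hp; lia].
    + exists (S n0); intros n Hn.
      destruct (Nat.eq_dec n (S n0)) as [->|]; [lra|].
      eapply Rle_trans; [apply Hp; lia | lra].
Qed.

(** Growth of [M] at ratio [/ l] makes all late terms at most 1, which is the term of index 0; so
    finitely many indices compete. *)
Lemma max_term (M : nat -> R) (l : R) :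
  weight_sequence M -> nonanalytic M -> 0 < l ->
  exists p, forall m, l ^ m / M m <= l ^ p / M p.
Proof.
  intros HM Hna Hl; assert (Hil := Rinv_0_lt_compat l Hl).
  destruct (nonanalytic_growth M (/ l) HM Hna Hil) as [n0 Hn0].
  destruct HM as (Hpos & H0 & _).
  destruct (max_exists (fun m => l ^ m / M m) n0) as [p Hp].
  exists p; intros m; destruct (Nat.le_gt_cases m n0) as [Hm|Hm]; [auto|].
  eapply Rle_trans; [|apply (Hp 0%nat); lia].
  rewrite H0, pow_O, Rdiv_1_r.
  apply Rle_div_l; [apply Hpos|].
  specialize (Hn0 m ltac:(lia)).
  assert (1 <= INR (Factorial.fact m)).
  { apply (le_INR 1); assert (H := Factorial.lt_O_fact m); lia. }
  assert (Hlm : 0 < l ^ m) by (apply pow_lt, Hl).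
  rewrite pow_inv in Hn0.
  assert (l ^ m * 1 <= l ^ m * (/ l ^ m * M m))
    by (apply Rmult_le_compat_l; lra).
  rewrite <- Rmult_assoc, Rinv_r in H1 by lra; lra.
Qed.

(* Otherwise the maximal term would grow polynomially. *)
Lemma max_term_jump (M : nat -> R) (r K L : R) :
  weight_sequence M -> nonanalytic M -> 1 < r -> 0 < K -> 0 < L ->
  exists l p, L <= l /\ forall m, K * (l ^ m / M m) <= (r * l) ^ p / M p.
Proof.
  intros HM Hna Hr HK HL; apply NNPP; intros Hno.
  destruct (max_term M L HM Hna HL) as [q Hq].
  destruct HM as (Hpos & _ & _).
  set (G := L ^ q / M q) in *.
  assert (Hri : forall i, 1 <= r ^ i) by (intros i; apply pow_R1_Rle; lra).
  (* Without a jump, each multiplication of the argument by [r] raises the maximal term at most by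
     the factor [K]. *)
  assert (Hgrow : forall i p, (r ^ i * L) ^ p / M p <= K ^ i * G).
  { induction i as [|i IH]; intros p.
    - simpl; rewrite !Rmult_1_l; apply Hq.
    - apply Rnot_lt_le; intros Hlt; apply Hno.
      exists (r ^ i * L), p; split; [specialize (Hri i); nra|].
      intros m; rewrite <- Rmult_assoc.
      change (r * r ^ i) with (r ^ S i).
      eapply Rle_trans; [|left; exact Hlt].
      simpl; rewrite Rmult_assoc; apply Rmult_le_compat_l; [lra | apply IH]. }
  (* With [r ^ p >= 2 * K], the single term of index [p] gains a factor [2 * K] per step and outruns
     [K ^ i * G]. *)
  destruct (Pow_x_infinity r ltac:(rewrite Rabs_pos_eq; lra) (2 * K))
    as [p Hp].
  specialize (Hp p (Nat.le_refl p)).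
  rewrite Rabs_pos_eq in Hp by (specialize (Hri p); lra).
  set (D := G * M p / L ^ p).
  destruct (Pow_x_infinity 2 ltac:(rewrite Rabs_pos_eq; lra) (D + 1)) as [i Hi].
  specialize (Hi i (Nat.le_refl i)).
  rewrite Rabs_pos_eq in Hi by (apply pow_le; lra).
  specialize (Hgrow i p).
  apply (proj1 (Rle_div_l _ _ _ (Hpos p))) in Hgrow.
  rewrite Rpow_mult_distr in Hgrow.
  assert (HLp : 0 < L ^ p) by (apply pow_lt, HL).
  assert (HKi : 0 < K ^ i) by (apply pow_lt, HK).
  assert (Hpi : 2 ^ i * K ^ i <= (r ^ i) ^ p).
  { rewrite <- Rpow_mult_distr, <- pow_mult, Nat.mul_comm, pow_mult.
    apply pow_incr; lra. }
  assert (HD : K ^ i * G * M p = K ^ i * D * L ^ p) by (unfold D; field; lra).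
  assert (K ^ i * (2 ^ i * L ^ p) <= K ^ i * (D * L ^ p)) by nra.
  apply Rmult_le_reg_l in H; [|exact HKi].
  apply Rmult_le_reg_r in H; lra.
Qed.

(** The quotient of [INR p ^ p] by the factorial is one term of the power series of
    [exp (INR p)]. *)
Lemma pow_self_le_exp_fact (p : nat) :
  INR p ^ p <= exp 1 ^ p * INR (Factorial.fact p).
Proof.
  assert (H := exp_ge_taylor (INR p) p (pos_INR p)).
  assert (Hf := INR_fact_lt_0 p).
  assert (E : exp (INR p) = exp 1 ^ p)
    by (rewrite <- Rpower_pow by apply exp_pos; unfold Rpower;
        rewrite ln_exp, Rmult_1_r; reflexivity).
  rewrite <- E; apply Rle_div_l; [exact Hf|].
  eapply Rle_trans; [|exact H].
  destruct p as [|p]; [simpl; lra|].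
  rewrite tech5.
  rewrite <- (Rplus_0_l (INR (S p) ^ S p / _)) at 1.
  apply Rplus_le_compat_r, cond_pos_sum; intros k.
  apply Rdiv_le_0_compat; [apply pow_le, pos_INR | apply INR_fact_lt_0].
Qed.

(* Since [M] beats [p!] exponentially, only the terms with [p = o(l)] matter in
   the maximal term of [l ^ p / M p]. *)
Lemma tail_terms_small (M : nat -> R) (C eps : R) :
  weight_sequence M -> nonanalytic M -> 0 < C -> 0 < eps ->
  exists L, forall l p, L <= l -> 0 < l -> eps * l < INR p -> (C * l) ^ p <= M p.
Proof.
  intros HM Hna HC Heps.
  assert (He := exp_pos 1).
  (* Chosen to make [C / eps * exp 1 * eta = 1]; the three factors come from [l < INR p / eps], from
     the bound on [INR p ^ p], and from the growth of [M]. *)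
  set (eta := eps / (C * exp 1)).
  assert (Heta : 0 < eta) by (apply Rdiv_lt_0_compat; nra).
  destruct (nonanalytic_growth M eta HM Hna Heta) as [n0 Hn0].
  exists (INR n0 / eps); intros l p Hl Hl0 Hp.
  assert (Hn : (n0 <= p)%nat).
  { apply INR_le; apply Rle_div_l in Hl; lra. }
  specialize (Hn0 p Hn); assert (Hs := pow_self_le_exp_fact p).
  assert (Hc : (C * l) ^ p <= (C / eps * INR p) ^ p).
  { apply pow_incr; split; [nra|].
    replace (C * l) with (C / eps * (eps * l)) by (field; lra).
    apply Rmult_le_compat_l; [|lra].
    apply Rdiv_le_0_compat; lra. }
  eapply Rle_trans; [exact Hc|].
  rewrite Rpow_mult_distr.
  assert (Hk : 0 < (C / eps) ^ p)
    by (apply pow_lt, Rdiv_lt_0_compat; lra).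
  assert (Hep : 0 < exp 1 ^ p) by (apply pow_lt, He).
  apply Rle_trans with ((C / eps) ^ p * (exp 1 ^ p * (eta ^ p * M p))).
  - apply Rmult_le_compat_l; [lra|].
    eapply Rle_trans; [exact Hs|]; apply Rmult_le_compat_l; lra.
  - rewrite <- !Rmult_assoc, <- !Rpow_mult_distr.
    replace (C / eps * exp 1 * eta) with 1 by (unfold eta; field; lra).
    rewrite pow1; lra.
Qed.

(** * Derivatives on the unit interval *)

Definition real_derive01 (f df : R -> R) : Prop :=
  forall x, I01 x -> forall eps, 0 < eps ->
  exists d, 0 < d /\ forall y, I01 y -> Rabs (y - x) < d ->
    Rabs (f y - f x - df x * (y - x)) <= eps * Rabs (y - x).

Lemma norm_Cmod (z : C) : @norm R_AbsRing C_R_NormedModule z = Cmod z.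
Proof.
  change (sqrt (Rabs (fst z) ^ 2 + Rabs (snd z) ^ 2)
          = sqrt (fst z ^ 2 + snd z ^ 2)).
  rewrite !pow2_abs; reflexivity.
Qed.

Lemma Cmod_le_Rabs_plus (z : C) : Cmod z <= Rabs (fst z) + Rabs (snd z).
Proof.
  assert (H1 := Rabs_pos (fst z)); assert (H2 := Rabs_pos (snd z)).
  rewrite <- (sqrt_pow2 (Rabs (fst z) + Rabs (snd z))) by lra.
  apply sqrt_le_1_alt; rewrite <- (pow2_abs (fst z)), <- (pow2_abs (snd z)); nra.
Qed.

Lemma fst_le_Cmod (z : C) : Rabs (fst z) <= Cmod z.
Proof. eapply Rle_trans; [apply Rmax_l | apply Rmax_Cmod]. Qed.

Lemma snd_le_Cmod (z : C) : Rabs (snd z) <= Cmod z.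
Proof. eapply Rle_trans; [apply Rmax_r | apply Rmax_Cmod]. Qed.

Lemma is_derive01_components (f df : R -> C) :
  is_derive01 f df <->
  real_derive01 (fun x => fst (f x)) (fun x => fst (df x)) /\
  real_derive01 (fun x => snd (f x)) (fun x => snd (df x)).
Proof.
  split.
  - intros H; split; intros x Hx eps Heps;
      destruct (H x Hx) as [_ Hd];
      destruct (Hd x (fun P HP => filter_imp P _ (fun y Hy _ => Hy) HP)
                  (mkposreal eps Heps)) as [d Hdd];
      (exists d; split; [apply cond_pos|]);
      intros y Hy Hyx; specialize (Hdd y Hyx Hy); cbv beta in Hdd;
      rewrite norm_Cmod in Hdd; (eapply Rle_trans; [|exact Hdd]).
    + eapply Rle_trans; [|apply fst_le_Cmod]; right; f_equal; simpl.
      change (fst (f y) - fst (f x) - fst (df x) * (y - x)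
              = fst (f y) - fst (f x) - (y - x) * fst (df x)); ring.
    + eapply Rle_trans; [|apply snd_le_Cmod]; right; f_equal; simpl.
      change (snd (f y) - snd (f x) - snd (df x) * (y - x)
              = snd (f y) - snd (f x) - (y - x) * snd (df x)); ring.
  - intros [H1 H2] x Hx; split.
    { apply (is_linear_scal_l (K := R_AbsRing) (V := C_R_NormedModule)). }
    intros x' Hx' eps.
    assert (HF : ProperFilter' (within I01 (locally x))).
    { split; [|apply within_filter, locally_filter].
      intros HF; exact (locally_singleton _ _ HF Hx). }
    assert (E : x' = x).
    { apply (is_filter_lim_unique (K := R_AbsRing) (V := R_NormedModule)
               (F := within I01 (locally x))); [exact Hx'|].
      intros P HP; apply filter_imp with (2 := HP); auto. }
    subst x'.
    assert (Heps : 0 < eps / 2) by (assert (H := cond_pos eps); lra).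
    destruct (H1 x Hx _ Heps) as (d1 & Hd1 & B1).
    destruct (H2 x Hx _ Heps) as (d2 & Hd2 & B2).
    assert (Hd : 0 < Rmin d1 d2) by (apply Rmin_pos; auto).
    exists (mkposreal _ Hd); intros y Hyx Hy.
    change (Rabs (y - x) < Rmin d1 d2) in Hyx.
    specialize (B1 y Hy (Rlt_le_trans _ _ _ Hyx (Rmin_l _ _))).
    specialize (B2 y Hy (Rlt_le_trans _ _ _ Hyx (Rmin_r _ _))).
    rewrite norm_Cmod; eapply Rle_trans; [apply Cmod_le_Rabs_plus|].
    change (Rabs (fst (f y) - fst (f x) - (y - x) * fst (df x))
            + Rabs (snd (f y) - snd (f x) - (y - x) * snd (df x))
            <= eps * Rabs (y - x)).
    rewrite !(Rmult_comm (y - x)); lra.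
Qed.

Lemma real_derive01_zero : real_derive01 (fun _ => 0) (fun _ => 0).
Proof.
  intros x _ eps Heps; exists 1; split; [lra|]; intros y _ _.
  replace (0 - 0 - 0 * (y - x)) with 0 by ring.
  rewrite Rabs_R0; apply Rmult_le_pos; [lra | apply Rabs_pos].
Qed.

Lemma is_derive01_RtoC (f df : R -> R) :
  real_derive01 f df -> is_derive01 (fun x => RtoC (f x)) (fun x => RtoC (df x)).
Proof.
  intros H; apply is_derive01_components; split;
    [exact H | exact real_derive01_zero].
Qed.

Lemma real_derive01_of_is_derive (f df : R -> R) :
  (forall x, is_derive f x (df x)) -> real_derive01 f df.
Proof.
  intros H x Hx eps Heps.
  destruct (H x) as [_ Hd].
  destruct (Hd x (fun P HP => HP) (mkposreal eps Heps)) as [d Hdd].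
  exists d; split; [apply cond_pos|]; intros y _ Hyx.
  rewrite Rmult_comm; apply (Hdd y Hyx).
Qed.

Lemma is_derive_of_real_derive01 (f df : R -> R) (x : R) :
  real_derive01 f df -> 0 < x < 1 -> is_derive f x (df x).
Proof.
  intros H Hx; split.
  { apply (is_linear_scal_l (K := R_AbsRing) (V := R_NormedModule)). }
  intros x' Hx' eps.
  apply (is_filter_lim_locally_unique (V := R_NormedModule)) in Hx'; subst x'.
  destruct (H x ltac:(split; lra) eps (cond_pos eps)) as (d & Hd & B).
  assert (Hd' : 0 < Rmin d (Rmin x (1 - x)))
    by (repeat apply Rmin_pos; lra).
  exists (mkposreal _ Hd'); intros y Hyx.
  change (Rabs (y - x) < Rmin d (Rmin x (1 - x))) in Hyx.
  assert (L1 := Rmin_l d (Rmin x (1 - x))).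
  assert (L2 := Rmin_r d (Rmin x (1 - x))).
  assert (L3 := Rmin_l x (1 - x)); assert (L4 := Rmin_r x (1 - x)).
  assert (Hy := Rabs_le_between' y x (Rmin x (1 - x))).
  assert (Hy' : I01 y) by (destruct Hy as [Hy _]; specialize (Hy ltac:(lra)); split; lra).
  specialize (B y Hy' ltac:(lra)); rewrite Rmult_comm in B; exact B.
Qed.

Lemma is_derive01_fst (f df : R -> C) (x : R) :
  is_derive01 f df -> 0 < x < 1 ->
  is_derive (fun x => fst (f x)) x (fst (df x)).
Proof.
  intros H Hx; apply is_derive01_components in H.
  apply (is_derive_of_real_derive01 _ (fun x => fst (df x)) x (proj1 H) Hx).
Qed.

(** Composing with this retraction turns continuity relative to [0,1] into continuity on the line,
    the form in which the extreme value theorem applies. *)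
Definition clamp (x : R) : R := Rmax 0 (Rmin 1 x).

Lemma clamp_I01 (x : R) : I01 (clamp x).
Proof.
  unfold clamp, I01, Rmax, Rmin.
  destruct (Rle_dec 1 x); destruct (Rle_dec 0 _); lra.
Qed.

Lemma clamp_id (x : R) : I01 x -> clamp x = x.
Proof.
  unfold clamp, I01, Rmax, Rmin; intros Hx.
  destruct (Rle_dec 1 x); destruct (Rle_dec 0 _); lra.
Qed.

Lemma clamp_lipschitz (x y : R) : Rabs (clamp y - clamp x) <= Rabs (y - x).
Proof.
  unfold clamp, Rmax, Rmin.
  destruct (Rle_dec 1 x); destruct (Rle_dec 1 y);
    repeat destruct (Rle_dec 0 _); unfold Rabs;
    repeat destruct (Rcase_abs _); lra.
Qed.

Lemma real_derive01_continuity (f df : R -> R) :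
  real_derive01 f df -> continuity (fun x => f (clamp x)).
Proof.
  intros H x eps Heps.
  destruct (H (clamp x) (clamp_I01 x) 1 Rlt_0_1) as (d & Hd & B).
  set (K := Rabs (df (clamp x)) + 1).
  assert (HK : 0 < K) by (unfold K; assert (Hp := Rabs_pos (df (clamp x))); lra).
  exists (Rmin d (eps / K)); split.
  { apply Rmin_pos; [exact Hd | apply Rdiv_lt_0_compat; lra]. }
  intros y [_ Hy]; simpl in Hy |- *; unfold Rdist in *.
  assert (L1 := Rmin_l d (eps / K)); assert (L2 := Rmin_r d (eps / K)).
  assert (Hc := clamp_lipschitz x y).
  specialize (B (clamp y) (clamp_I01 y) ltac:(lra)).
  assert (T := Rabs_triang (f (clamp y) - f (clamp x)
                            - df (clamp x) * (clamp y - clamp x))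
                 (df (clamp x) * (clamp y - clamp x))).
  rewrite Rabs_mult in T.
  replace (f (clamp y) - f (clamp x) - df (clamp x) * (clamp y - clamp x)
           + df (clamp x) * (clamp y - clamp x))
    with (f (clamp y) - f (clamp x)) in T by ring.
  apply Rle_lt_trans with (K * Rabs (clamp y - clamp x)); [unfold K; lra|].
  apply Rle_lt_trans with (K * Rabs (y - x));
    [apply Rmult_le_compat_l; lra|].
  apply Rlt_le_trans with (K * (eps / K));
    [apply Rmult_lt_compat_l; lra | right; field; lra].
Qed.

Lemma real_derive01_bounded (f df : R -> R) :
  real_derive01 f df -> exists B, forall x, I01 x -> Rabs (f x) <= B.
Proof.
  intros H.
  destruct (continuity_ab_maj (fun x => Rabs (f (clamp x))) 0 1) as [m [Hm _]].
  - lra.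
  - intros c _; apply (continuity_pt_comp (fun x => f (clamp x)) Rabs).
    + apply (real_derive01_continuity f df H).
    + apply Rcontinuity_abs.
  - exists (Rabs (f (clamp m))); intros x Hx.
    rewrite <- (clamp_id x Hx) at 1; apply (Hm x Hx).
Qed.

(** A finite bound has to come first, since [real] sends an infinite supremum to 0; the value at 0
    excludes minus infinity. *)
Lemma supnorm01_lub (f : R -> C) (B : R) :
  (forall x, I01 x -> Cmod (f x) <= B) ->
  0 <= real (supnorm01 f) <= B /\
  (forall x, I01 x -> Cmod (f x) <= real (supnorm01 f)).
Proof.
  intros HB; unfold supnorm01.
  set (E := fun r => exists x, I01 x /\ r = Cmod (f x)).
  destruct (Lub_Rbar_correct E) as [Hub Hleast].
  assert (H0 : I01 0) by (split; lra).
  assert (Hl : Rbar_le (Lub_Rbar E) B).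
  { apply Hleast; intros r [x [Hx ->]]; apply HB, Hx. }
  assert (Hu : forall x, I01 x -> Rbar_le (Cmod (f x)) (Lub_Rbar E)).
  { intros x Hx; apply Hub; exists x; auto. }
  assert (Hu0 := Hu 0 H0).
  destruct (Lub_Rbar E) as [l| |]; simpl in *; try easy.
  assert (Hp := Cmod_ge_0 (f 0)); split; [lra | exact Hu].
Qed.

Lemma is_derive01_supnorm (f df : R -> C) :
  is_derive01 f df ->
  forall x, I01 x -> Cmod (f x) <= real (supnorm01 f).
Proof.
  intros H; apply is_derive01_components in H; destruct H as [H1 H2].
  destruct (real_derive01_bounded _ _ H1) as [B1 HB1].
  destruct (real_derive01_bounded _ _ H2) as [B2 HB2].
  apply (supnorm01_lub f (B1 + B2)); intros x Hx.
  specialize (HB1 x Hx); specialize (HB2 x Hx).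
  eapply Rle_trans; [|apply Rplus_le_compat; [exact HB1 | exact HB2]].
  apply Cmod_le_Rabs_plus.
Qed.

(** What is kept of membership in D: ordinary derivatives on the open interval and bounded, instead
    of summable, quotients by [M n]. These bounds simply add under sums. *)
Definition derivatives_bounded (M : nat -> R) (h : R -> R) (B : R) : Prop :=
  exists v : nat -> R -> R,
    (forall x, 0 < x < 1 -> v 0%nat x = h x) /\
    (forall n x, 0 < x < 1 -> is_derive (v n) x (v (S n) x)) /\
    (forall n x, 0 < x < 1 -> Rabs (v n x) <= B * M n).

Lemma in_D_derivatives_bounded (M : nat -> R) (h : R -> R) :
  weight_sequence M -> in_D M (fun x => RtoC (h x)) ->
  exists B, 0 < B /\ derivatives_bounded M h B.
Proof.
  intros [Hpos _] (g & [Hg0 Hg] & Hs).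
  apply ex_series_lim_0, is_lim_seq_Reals in Hs.
  destruct (maj_by_pos _ (exist _ 0 Hs)) as (B & HB & Hbd).
  exists B; split; [exact HB|].
  exists (fun n x => fst (g n x)); split; [|split].
  - intros x Hx; rewrite Hg0 by (split; lra); reflexivity.
  - intros n x Hx; apply (is_derive01_fst (g n) (g (S n)) x (Hg n) Hx).
  - intros n x Hx.
    apply Rle_trans with (Cmod (g n x)); [apply fst_le_Cmod|].
    eapply Rle_trans;
      [apply (is_derive01_supnorm _ _ (Hg n)); split; lra|].
    apply Rle_div_l; [apply Hpos|].
    eapply Rle_trans; [apply Rle_abs | apply Hbd].
Qed.

Lemma in_D_id (M : nat -> R) : in_D M (fun x => RtoC x).
Proof.
  exists (fun n x => RtoC (match n with 0%nat => x | 1%nat => 1 | _ => 0 end)).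
  split; [split; [reflexivity|]|].
  - intros n; apply is_derive01_RtoC, real_derive01_of_is_derive; intros x.
    destruct n as [|[|n]]; auto_derive; easy.
  - apply (ex_series_incr_n _ 2).
    apply ex_series_ext with (fun _ => 0).
    + intros n; simpl.
      destruct (supnorm01_lub (fun _ => RtoC 0) 0) as [H _].
      { intros x _; rewrite Cmod_0; lra. }
      replace (real (supnorm01 (fun _ => RtoC 0))) with 0 by lra.
      unfold Rdiv; ring.
    + exists 0; apply is_series_Reals.
      intros eps Heps; exists 0%nat; intros n _.
      rewrite sum_eq_R0 by auto; unfold Rdist; rewrite Rminus_0_r, Rabs_R0; lra.
Qed.

(** * Cosine series *)

Lemma Rabs_cos_le (x : R) : Rabs (cos x) <= 1.
Proof. apply Rabs_le, COS_bound. Qed.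

Lemma sin_lipschitz (x y : R) : Rabs (sin y - sin x) <= Rabs (y - x).
Proof.
  destruct (MVT_gen sin x y cos) as [c [_ Hc]].
  - intros z _; apply is_derive_Reals, derivable_pt_lim_sin.
  - intros z _; apply continuity_sin.
  - rewrite Hc, Rabs_mult.
    assert (H := Rabs_cos_le c); assert (Hp := Rabs_pos (y - x)).
    nra.
Qed.

Lemma cos_taylor_1 (u t : R) :
  Rabs (cos (u + t) - cos u - t * cos (u + PI / 2)) <= t ^ 2.
Proof.
  destruct (MVT_gen cos u (u + t) (fun x => - sin x)) as [c [Hc1 Hc2]].
  - intros z _; apply is_derive_Reals, derivable_pt_lim_cos.
  - intros z _; apply continuity_cos.
  - rewrite Hc2, cos_plus, cos_PI2, sin_PI2.
    replace (- sin c * (u + t - u) - t * (cos u * 0 - sin u * 1))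
      with (t * (sin u - sin c)) by ring.
    rewrite Rabs_mult, <- (pow2_abs t); simpl; rewrite Rmult_1_r.
    apply Rmult_le_compat_l; [apply Rabs_pos|].
    eapply Rle_trans; [apply sin_lipschitz|].
    unfold Rmin, Rmax in Hc1; destruct (Rle_dec u (u + t));
      unfold Rabs; repeat destruct (Rcase_abs _); lra.
Qed.

(** Meant for termwise differentiation: quadratic remainders can be summed over a series. *)
Lemma is_derive_of_quadratic (f : R -> R) (x l K : R) :
  (forall h, Rabs (f (x + h) - f x - h * l) <= K * h ^ 2) -> is_derive f x l.
Proof.
  intros H; apply is_derive_Reals; intros eps Heps.
  assert (HK : 0 < Rabs K + 1) by (assert (Hp := Rabs_pos K); lra).
  assert (Hd : 0 < eps / (Rabs K + 1)) by (apply Rdiv_lt_0_compat; lra).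
  exists (mkposreal _ Hd); intros h Hh Hlt; simpl in Hlt.
  replace ((f (x + h) - f x) / h - l) with ((f (x + h) - f x - h * l) / h)
    by (field; exact Hh).
  rewrite Rabs_div by exact Hh.
  assert (Hah : 0 < Rabs h) by (apply Rabs_pos_lt, Hh).
  apply Rlt_div_l; [exact Hah|].
  apply Rle_lt_trans with (Rabs K * Rabs h * Rabs h).
  - eapply Rle_trans; [apply H|].
    rewrite <- (pow2_abs h); assert (HK' := Rle_abs K); nra.
  - apply Rmult_lt_compat_r; [exact Hah|].
    apply Rlt_div_r in Hlt; [|exact HK]; nra.
Qed.

Lemma ex_series_half (K : R) : ex_series (fun j => K * (/ 2) ^ j).
Proof.
  apply (ex_series_scal_l (K := R_AbsRing) (V := R_NormedModule) K).
  apply ex_series_geom; rewrite Rabs_pos_eq; lra.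
Qed.

Lemma Series_half (K : R) : Series (fun j => K * (/ 2) ^ j) = 2 * K.
Proof.
  rewrite Series_scal_l, Series_geom by (rewrite Rabs_pos_eq; lra); field.
Qed.

Lemma ex_series_le_half (u : nat -> R) (K : R) :
  (forall j, Rabs (u j) <= K * (/ 2) ^ j) -> ex_series u.
Proof.
  intros H; apply (ex_series_le (K := R_AbsRing) (V := R_CompleteNormedModule)
                     u (fun j => K * (/ 2) ^ j)); [exact H | apply ex_series_half].
Qed.

Lemma Series_le_half (u : nat -> R) (K : R) :
  (forall j, Rabs (u j) <= K * (/ 2) ^ j) -> Rabs (Series u) <= 2 * K.
Proof.
  intros H; rewrite <- Series_half.
  eapply Rle_trans; [apply Series_Rabs|].
  - apply (ex_series_le_half _ K); intros j; rewrite Rabs_Rabsolu; apply H.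
  - apply Series_le; [|apply ex_series_half].
    intros j; split; [apply Rabs_pos | apply H].
Qed.

(** The [n]-th formal derivative of the sum of [a j * cos (l j * x)]; phase shifts give all orders
    one formula. *)
Definition cos_series (a l : nat -> R) (n : nat) (x : R) : R :=
  Series (fun j => a j * l j ^ n * cos (l j * x + INR n * (PI / 2))).

(** The remainder of the [j]-th term is controlled by [a j * l j ^ (n + 2) * h ^ 2], so the
    hypothesis at order [n + 2] sums the remainders. *)
Lemma cos_series_derive (a l K : nat -> R) (n : nat) (x : R) :
  (forall n j, Rabs (a j * l j ^ n) <= K n * (/ 2) ^ j) ->
  is_derive (cos_series a l n) x (cos_series a l (S n) x).
Proof.
  intros HK.
  assert (Hcos : forall n j u, Rabs (a j * l j ^ n * cos u) <= K n * (/ 2) ^ j).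
  { intros m j u; rewrite Rabs_mult.
    assert (H1 := Rabs_cos_le u); assert (H2 := HK m j).
    assert (H3 := Rabs_pos (a j * l j ^ m)); nra. }
  assert (Hex : forall m y,
    ex_series (fun j => a j * l j ^ m * cos (l j * y + INR m * (PI / 2))))
    by (intros m y; apply (ex_series_le_half _ (K m)); auto).
  apply (is_derive_of_quadratic _ _ _ (2 * K (S (S n)))); intros h.
  unfold cos_series.
  rewrite <- Series_minus, <- Series_scal_l, <- Series_minus by
    (try apply (ex_series_minus (K := R_AbsRing) (V := R_NormedModule));
     try apply (ex_series_scal_l (K := R_AbsRing) (V := R_NormedModule));
     apply Hex).
  replace (2 * K (S (S n)) * h ^ 2) with (2 * (K (S (S n)) * h ^ 2)) by ring.
  apply Series_le_half; intros j.
  replace (a j * l j ^ n * cos (l j * (x + h) + INR n * (PI / 2)) -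
           a j * l j ^ n * cos (l j * x + INR n * (PI / 2)) -
           h * (a j * l j ^ S n * cos (l j * x + INR (S n) * (PI / 2))))
    with (a j * l j ^ n *
          (cos (l j * x + INR n * (PI / 2) + l j * h)
           - cos (l j * x + INR n * (PI / 2))
           - l j * h * cos (l j * x + INR n * (PI / 2) + PI / 2))).
  - rewrite Rabs_mult.
    eapply Rle_trans;
      [apply Rmult_le_compat_l; [apply Rabs_pos | apply cos_taylor_1]|].
    replace (Rabs (a j * l j ^ n) * (l j * h) ^ 2)
      with (Rabs (a j * l j ^ S (S n)) * h ^ 2).
    + assert (Hh := pow2_ge_0 h); assert (Hj := HK (S (S n)) j); nra.
    + rewrite <- (pow2_abs (l j * h)), <- (pow2_abs h), !Rabs_mult,
        <- !RPow_abs; simpl; ring.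
  - rewrite S_INR; simpl.
    replace (l j * (x + h) + INR n * (PI / 2))
      with (l j * x + INR n * (PI / 2) + l j * h) by ring.
    replace (l j * x + (INR n + 1) * (PI / 2))
      with (l j * x + INR n * (PI / 2) + PI / 2) by ring.
    ring.
Qed.

(** The margin [r > 1] makes the norm finite: the [n]-th derivative is at most
    [2 * K * M n * (/ r) ^ n], which leaves a geometric series. *)
Lemma cos_series_in_D (M a l : nat -> R) (r K : R) :
  weight_sequence M -> 1 < r -> 0 < K ->
  (forall j, 0 <= a j) -> (forall j, 0 <= l j) ->
  (forall j m, a j * (r * l j) ^ m <= K * (/ 2) ^ j * M m) ->
  in_D M (fun x => RtoC (cos_series a l 0 x)).
Proof.
  intros [Hpos _] Hr HK Ha Hl H.
  set (Kn := fun n => K * M n * (/ r) ^ n).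
  assert (Hrn : forall n, 0 < r ^ n) by (intros n; apply pow_lt; lra).
  assert (Hbound : forall n j, Rabs (a j * l j ^ n) <= Kn n * (/ 2) ^ j).
  { intros n j; unfold Kn.
    rewrite Rabs_pos_eq by (apply Rmult_le_pos; [|apply pow_le]; auto).
    specialize (H j n); rewrite Rpow_mult_distr in H.
    rewrite pow_inv; specialize (Hrn n).
    apply (Rmult_le_reg_l (r ^ n)); [exact Hrn|].
    replace (r ^ n * (K * M n * / r ^ n * (/ 2) ^ j))
      with (K * (/ 2) ^ j * M n) by (field; lra).
    lra. }
  exists (fun n x => RtoC (cos_series a l n x)); split; [split|].
  - reflexivity.
  - intros n; apply is_derive01_RtoC, real_derive01_of_is_derive; intros x.
    apply (cos_series_derive a l Kn n x Hbound).
  - apply (ex_series_le (K := R_AbsRing) (V := R_CompleteNormedModule)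
             _ (fun n => 2 * K * (/ r) ^ n)).
    + intros n.
      destruct (supnorm01_lub (fun x => RtoC (cos_series a l n x)) (2 * Kn n))
        as [Hs _].
      { intros x _; rewrite Cmod_R; apply Series_le_half; intros j.
        rewrite Rabs_mult.
        assert (H1 := Rabs_cos_le (l j * x + INR n * (PI / 2))).
        assert (H2 := Hbound n j); assert (H3 := Rabs_pos (a j * l j ^ n)).
        nra. }
      specialize (Hpos n).
      change (Rabs (real (supnorm01 (fun x => RtoC (cos_series a l n x))) / M n)
              <= 2 * K * (/ r) ^ n).
      rewrite Rabs_pos_eq by (apply Rdiv_le_0_compat; lra).
      apply Rle_div_l; [exact Hpos|]; unfold Kn in Hs; lra.
    + apply (ex_series_scal_l (K := R_AbsRing) (V := R_NormedModule)).
      apply ex_series_geom.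
      rewrite Rabs_pos_eq by (left; apply Rinv_0_lt_compat; lra).
      rewrite <- Rinv_1; apply Rinv_lt_contravar; lra.
Qed.

Lemma cos_in_D (M : nat -> R) (l : R) :
  weight_sequence M -> nonanalytic M -> 0 < l ->
  in_D M (fun x => RtoC (cos (l * x))).
Proof.
  intros HM Hna Hl.
  (* The cosine is handled as a series with one nonzero coefficient and margin [r = 2], hence the
     maximal term at [2 * l]. *)
  destruct (max_term M (2 * l) HM Hna ltac:(lra)) as [q Hq].
  assert (Hpos := proj1 HM).
  set (a := fun j => match j with 0%nat => 1 | _ => 0 end).
  assert (Hin : in_D M (fun x => RtoC (cos_series a (fun _ => l) 0 x))).
  { apply (cos_series_in_D M a (fun _ => l) 2 ((2 * l) ^ q / M q) HM); try lra.
    - apply Rdiv_lt_0_compat; [apply pow_lt; lra | apply Hpos].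
    - intros [|j]; simpl; lra.
    - intros; lra.
    - intros j m; specialize (Hq m).
      apply (proj1 (Rle_div_l _ _ _ (Hpos m))) in Hq.
      destruct j as [|j]; simpl (a _).
      + rewrite pow_O, Rmult_1_r, Rmult_1_l; exact Hq.
      + assert (0 < (2 * l) ^ q / M q)
          by (apply Rdiv_lt_0_compat; [apply pow_lt; lra | apply Hpos]).
        assert (0 < (/ 2) ^ S j) by (apply pow_lt; lra).
        rewrite Rmult_0_l; left;
          apply Rmult_lt_0_compat; [apply Rmult_lt_0_compat|]; auto. }
  destruct Hin as (g & [Hg0 Hg] & Hs).
  exists g; split; [split; [|exact Hg] | exact Hs].
  intros x Hx; rewrite (Hg0 x Hx); f_equal; unfold cos_series.
  rewrite Series_incr_1.
  - rewrite (Series_ext _ (fun j => 0 * (/ 2) ^ j)), Series_half.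
    + simpl; rewrite Rmult_0_l, Rplus_0_r; ring.
    + intros j; simpl; ring.
  - apply (ex_series_le_half _ 1); intros [|j]; simpl.
    + rewrite !Rmult_1_l; apply Rabs_cos_le.
    + rewrite !Rmult_0_l, Rabs_R0, Rmult_1_l.
      assert (0 < (/ 2) ^ j) by (apply pow_lt; lra); lra.
Qed.

(** * Combinations of functions with bounded derivatives *)

Lemma derivatives_bounded_ext (M : nat -> R) (f g : R -> R) (B : R) :
  (forall x, 0 < x < 1 -> f x = g x) ->
  derivatives_bounded M f B -> derivatives_bounded M g B.
Proof.
  intros E (v & V0 & V1 & V2); exists v; split; [|auto].
  intros x Hx; rewrite V0, E; auto.
Qed.

Lemma derivatives_bounded_plus (M : nat -> R) (f g : R -> R) (s A B : R) :
  Rabs s <= 1 ->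
  derivatives_bounded M f A -> derivatives_bounded M g B ->
  derivatives_bounded M (fun x => f x + s * g x) (A + B).
Proof.
  intros Hs (v & V0 & V1 & V2) (w & W0 & W1 & W2).
  exists (fun n x => v n x + s * w n x); split; [|split].
  - intros x Hx; rewrite V0, W0; auto.
  - intros n x Hx.
    apply (is_derive_plus (K := R_AbsRing) (V := R_NormedModule)); [auto|].
    apply (is_derive_scal (w n)); auto.
  - intros n x Hx; specialize (V2 n x Hx); specialize (W2 n x Hx).
    eapply Rle_trans; [apply Rabs_triang|]; rewrite Rabs_mult.
    assert (H := Rabs_pos (w n x)); assert (H' := Rabs_pos s); nra.
Qed.

(** * Alternation points of a cosine *)

Lemma cos_int_PI (z : Z) : cos (IZR z * PI) = 1 \/ cos (IZR z * PI) = -1.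
Proof.
  assert (H : sin (IZR z * PI) = 0) by (apply sin_eq_0_1; exists z; reflexivity).
  assert (H2 := sin2_cos2 (IZR z * PI)); rewrite H in H2; unfold Rsqr in H2.
  assert (E : (cos (IZR z * PI) - 1) * (cos (IZR z * PI) + 1) = 0) by lra.
  apply Rmult_integral in E; lra.
Qed.

Lemma cos_alternation_points (g : R -> R) (a b : R) (N : nat) :
  a < b ->
  (forall x, a <= x <= b -> continuity_pt g x) ->
  (forall x y, a <= x -> x < y -> y <= b -> g x < g y) ->
  PI * (INR N + 1) <= g b - g a ->
  exists y s, increasing_points a b (S N) y /\
    forall i, (i <= N)%nat -> (-1) ^ (i + s) * cos (g (y i)) = 1.
Proof.
  intros Hab Hc Hmono HN; assert (HP := PI_RGT_0).
  destruct (archimed (g a / PI)) as [Z1 Z2].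
  (* [IZR z * PI] is the first multiple of [PI] above [g a]. It may be as far as [g a + PI], so
     [N + 1] consecutive multiples need a range of [PI * (INR N + 1)]. *)
  set (z := up (g a / PI)) in *.
  assert (Hz1 : g a < IZR z * PI) by (apply Rlt_div_l; lra).
  assert (Hz2 : IZR z * PI <= g a + PI).
  { assert (IZR z - 1 <= g a / PI) by lra.
    apply Rle_div_r in H; [lra | exact HP]. }
  destruct (functional_choice (fun i x => (i <= N)%nat ->
              a <= x <= b /\ g x = (IZR z + INR i) * PI)) as [y Hy].
  { intros i; destruct (Compare_dec.le_dec i N) as [Hi|Hi];
      [|exists 0; lia].
    apply le_INR in Hi; assert (Hi0 := pos_INR i).
    assert (Hb : (IZR z + INR i) * PI <= g b) by nra.
    assert (Ha : g a < (IZR z + INR i) * PI) by nra.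
    destruct (Rle_lt_or_eq_dec _ _ Hb) as [Hlt|Heq].
    - destruct (Ranalysis5.IVT_interv (fun x => g x - (IZR z + INR i) * PI) a b)
        as [x [Hx Ex]]; try lra.
      + intros x Hx; apply continuity_pt_minus; [apply Hc, Hx|].
        apply continuity_pt_const; intros ? ?; reflexivity.
      + exists x; intros _; split; lra.
    - exists b; intros _; lra. }
  assert (Hsgn : exists s, (-1) ^ s * cos (IZR z * PI) = 1).
  { destruct (cos_int_PI z) as [->| ->]; [exists 0%nat | exists 1%nat]; simpl; ring. }
  destruct Hsgn as [s Hs]; exists y, s; split; [split|].
  - intros i Hi; apply Hy; lia.
  - intros i Hi.
    destruct (Hy i ltac:(lia)) as [Y1 E1]; destruct (Hy (S i) ltac:(lia)) as [Y2 E2].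
    apply Rnot_le_lt; intros Hle.
    rewrite S_INR in E2.
    destruct (Rle_lt_or_eq_dec _ _ Hle) as [Hlt|Heq].
    + specialize (Hmono (y (S i)) (y i)); nra.
    + rewrite Heq in E2; nra.
  - intros i Hi; destruct (Hy i Hi) as [_ ->].
    assert (E : forall k, cos ((IZR z + INR k) * PI) = (-1) ^ k * cos (IZR z * PI)).
    { induction k as [|k IH]; [simpl; rewrite Rplus_0_r; ring|].
      rewrite S_INR.
      replace ((IZR z + (INR k + 1)) * PI) with ((IZR z + INR k) * PI + PI) by ring.
      rewrite cos_antiperiodic, IH; simpl; ring. }
    rewrite E, pow_add.
    assert (Hsq : (-1) ^ i * (-1) ^ i = 1)
      by (rewrite <- Rpow_mult_distr; replace (-1 * -1) with 1 by ring; apply pow1).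
    replace ((-1) ^ i * (-1) ^ s * ((-1) ^ i * cos (IZR z * PI)))
      with ((-1) ^ i * (-1) ^ i * ((-1) ^ s * cos (IZR z * PI))) by ring.
    rewrite Hsq, Hs; ring.
Qed.

(** * The gliding hump *)

(** The new amplitude is [al / 8] divided by the maximal term at [d * l], which keeps the cosine
    small in D; the jump of the maximal term from [d * l] to [c * l] makes one derivative large
    nevertheless. *)
Lemma hump_step (M : nat -> R) (c d eps al T : R) :
  weight_sequence M -> nonanalytic M -> 1 < d -> d < c -> 0 < eps -> 0 < al ->
  exists (l : R) (m : nat) (al' : R),
    0 < l /\ 3 <= eps * l /\ INR (S m) <= eps * l /\
    0 < al' /\ al' <= al / 8 /\
    (forall i, al' * (d * l) ^ i <= al * M i) /\
    T * M (S m) <= al' * (c * l) ^ S m.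
Proof.
  intros HM Hna Hd Hdc Heps Hal.
  destruct (tail_terms_small M c eps HM Hna ltac:(lra) Heps) as [L HL].
  (* The 2 forces the jump term above 1, which excludes index 0, whose term is 1, and indices beyond
     [eps * l], whose terms are at most 1. The other entry makes up for the amplitude [al / 8]. *)
  set (K := Rmax 2 (8 * T / al)).
  assert (HK2 : 2 <= K) by apply Rmax_l.
  assert (HKT : 8 * T / al <= K) by apply Rmax_r.
  set (L' := Rmax (3 / eps) L).
  assert (HL3 : 3 / eps <= L') by apply Rmax_l.
  assert (HLL : L <= L') by apply Rmax_r.
  assert (H3 : 0 < 3 / eps) by (apply Rdiv_lt_0_compat; lra).
  assert (Hr : 1 < c / d) by (apply Rlt_div_r; lra).
  destruct (max_term_jump M (c / d) K (d * L') HM Hna Hr ltac:(lra) ltac:(nra))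
    as (x & p & Hx & Hp).
  assert (Hx0 : 0 < x) by nra.
  destruct (max_term M x HM Hna Hx0) as [q Hq].
  destruct HM as (Hpos & HM0 & _).
  set (l := x / d).
  assert (Ex : d * l = x) by (unfold l; field; lra).
  assert (Ec : c / d * x = c * l) by (unfold l; field; lra).
  assert (Hl : L' <= l) by nra.
  assert (Hl0 : 0 < l) by lra.
  rewrite Ec in Hp.
  set (G := x ^ q / M q) in *.
  assert (HG : 1 <= G).
  { specialize (Hq 0%nat); rewrite pow_O, HM0 in Hq; lra. }
  assert (Hbig : K * G <= (c * l) ^ p / M p) by apply Hp.
  destruct p as [|m].
  { rewrite pow_O, HM0 in Hbig; nra. }
  exists l, m, (al / 8 / G).
  assert (HaG : 0 < al / 8 / G) by (apply Rdiv_lt_0_compat; lra).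
  repeat split; auto.
  - apply Rle_trans with (eps * (3 / eps)); [right; field; lra|].
    apply Rmult_le_compat_l; lra.
  - apply Rnot_lt_le; intros Hlt.
    specialize (HL l (S m) ltac:(lra) Hl0 Hlt).
    assert ((c * l) ^ S m / M (S m) <= 1)
      by (apply Rle_div_l; [apply Hpos | lra]).
    nra.
  - apply Rle_div_l; [lra|]; nra.
  - intros i; rewrite Ex.
    specialize (Hq i); apply (proj1 (Rle_div_l _ _ _ (Hpos i))) in Hq.
    apply Rle_trans with (al / 8 / G * (G * M i)).
    + apply Rmult_le_compat_l; lra.
    + replace (al / 8 / G * (G * M i)) with (al / 8 * M i) by (field; lra).
      specialize (Hpos i); nra.
  - apply (proj2 (Rle_div_r _ _ _ (Hpos (S m)))) in Hbig.
    apply Rle_trans with (al / 8 / G * (K * G * M (S m)));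
      [|apply Rmult_le_compat_l; lra].
    replace (al / 8 / G * (K * G * M (S m))) with (al / 8 * K * M (S m))
      by (field; lra).
    apply Rmult_le_compat_r; [left; apply Hpos|].
    apply (proj1 (Rle_div_l _ _ _ Hal)) in HKT; lra.
Qed.

(* [B k] bounds the first [k] terms of the series, so that the [k]-th term
   dominates them in its [S (m k)]-th derivative. *)
Lemma hump_sequence (M : nat -> R) (phi : R -> R) (c d eps : R) :
  weight_sequence M -> nonanalytic M -> induces_endomorphism M phi ->
  1 < d -> d < c -> 0 < eps ->
  exists (l al B : nat -> R) (m : nat -> nat),
    (forall k, 0 < l k /\ 3 <= eps * l k /\ INR (S (m k)) <= eps * l k) /\
    (forall k, 0 < al k /\ al k <= 1 /\ al (S k) <= al k / 8) /\
    (forall k i, al k * (d * l k) ^ i <= (/ 2) ^ k * M i) /\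
    (forall k, 4 * (INR k + B k) * M (S (m k)) <= al k * (c * l k) ^ S (m k)) /\
    (forall k, exists b, B (S k) = B k + b /\
       derivatives_bounded M (fun x => cos (l k * phi x)) b) /\
    0 <= B 0%nat.
Proof.
  intros HM Hna Hphi Hd Hdc Heps.
  (* [s] holds the stage, the last amplitude and the bound for the earlier cosines; [t] is the
     choice made there. The premise [0 < al] sits inside so that every state admits a choice. *)
  set (good := fun (s : nat * (R * R)) (t : R * nat * (R * R)) =>
    let '(k, (al, B)) := s in
    let '(l, m, (al', B')) := t in
    0 < al ->
    (0 < l /\ 3 <= eps * l /\ INR (S m) <= eps * l) /\
    (0 < al' /\ al' <= al / 8) /\
    (forall i, al' * (d * l) ^ i <= al * M i) /\
    4 * (INR k + B) * M (S m) <= al' * (c * l) ^ S m /\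
    exists b, B' = B + b /\ derivatives_bounded M (fun x => cos (l * phi x)) b).
  assert (Hstep : forall s, exists t, good s t).
  { intros [k [al B]].
    destruct (Rlt_dec 0 al) as [Hal|Hal];
      [|exists (0, 0%nat, (0, 0)); intros H; contradiction].
    destruct (hump_step M c d eps al (4 * (INR k + B)) HM Hna Hd Hdc Heps Hal)
      as (l & m & al' & H1 & H2 & H3 & H4 & H5 & H6 & H7).
    destruct (in_D_derivatives_bounded M (fun x => cos (l * phi x)) HM) as [b [_ Hb]].
    { apply (Hphi (fun y => RtoC (cos (l * y)))), cos_in_D; auto. }
    exists (l, m, (al', B + b)); intros _; repeat split; auto.
    exists b; auto. }
  destruct (functional_choice _ Hstep) as [step Hgood].
  set (state := fix state k : R * R :=
    match k with 0%nat => (1, 0) | S k => snd (step (k, state k)) end).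
  set (l := fun k => fst (fst (step (k, state k)))).
  set (m := fun k => snd (fst (step (k, state k)))).
  (* [state k] is the situation before stage [k]: the amplitude chosen at that stage appears in
     [state (S k)], whereas [B k] covers only the terms before [k]. *)
  set (al := fun k => fst (state (S k))).
  set (B := fun k => snd (state k)).
  assert (H : forall k, 0 < fst (state k) ->
    (0 < l k /\ 3 <= eps * l k /\ INR (S (m k)) <= eps * l k) /\
    (0 < al k /\ al k <= fst (state k) / 8) /\
    (forall i, al k * (d * l k) ^ i <= fst (state k) * M i) /\
    4 * (INR k + B k) * M (S (m k)) <= al k * (c * l k) ^ S (m k) /\
    exists b, B (S k) = B k + b /\
      derivatives_bounded M (fun x => cos (l k * phi x)) b).
  { intros k Hk.
    assert (G := Hgood (k, state k)).
    unfold l, m, al, B; simpl (state (S k)).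
    destruct (state k) as [a0 b0].
    destruct (step (k, (a0, b0))) as [[l0 m0] [a1 b1]].
    exact (G Hk). }
  assert (Hst : forall k, 0 < fst (state k) <= (/ 2) ^ k).
  { induction k as [|k IH]; [simpl; lra|].
    destruct (H k (proj1 IH)) as (_ & [H1 H2] & _).
    change (fst (state (S k))) with (al k); simpl; lra. }
  assert (Hone : forall k, (/ 2) ^ k <= 1)
    by (intros k; rewrite <- (pow1 k); apply pow_incr; lra).
  exists l, al, B, m; split; [|split; [|split; [|split; [|split]]]].
  - intros k; apply (H k (proj1 (Hst k))).
  - intros k; destruct (H k (proj1 (Hst k))) as (_ & [H1 H2] & _).
    destruct (H (S k) H1) as (_ & [_ H3] & _).
    assert (H4 := Hst k); assert (H5 := Hone k).
    repeat split; auto; lra.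
  - intros k i; destruct (H k (proj1 (Hst k))) as (_ & _ & H1 & _).
    eapply Rle_trans; [apply H1|].
    apply Rmult_le_compat_r; [left; apply HM | apply Hst].
  - intros k; apply (H k (proj1 (Hst k))).
  - intros k; apply (H k (proj1 (Hst k))).
  - right; reflexivity.
Qed.

Lemma partial_sum_bounded (M : nat -> R) (phi : R -> R) (l al B : nat -> R) :
  (forall k, 0 < al k <= 1) -> 0 <= B 0%nat -> (forall n, 0 < M n) ->
  (forall k, exists b, B (S k) = B k + b /\
     derivatives_bounded M (fun x => cos (l k * phi x)) b) ->
  forall k, derivatives_bounded M
    (fun x => sum_f_R0 (fun j => al j * cos (l j * phi x)) k) (B (S k)).
Proof.
  intros Hal HB HM H.
  assert (H0 : derivatives_bounded M (fun _ => 0) (B 0%nat)).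
  { exists (fun _ _ => 0); split; [reflexivity | split].
    - intros n x _; apply (is_derive_const (K := R_AbsRing) (V := R_NormedModule)).
    - intros n x _; rewrite Rabs_R0; apply Rmult_le_pos; [exact HB | left; apply HM]. }
  assert (Hs : forall k, Rabs (al k) <= 1).
  { intros k; rewrite Rabs_pos_eq; specialize (Hal k); lra. }
  induction k as [|k IH].
  - destruct (H 0%nat) as (b & -> & Hb).
    eapply derivatives_bounded_ext;
      [|exact (derivatives_bounded_plus M _ _ _ _ _ (Hs 0%nat) H0 Hb)].
    intros x _; simpl; ring.
  - destruct (H (S k)) as (b & -> & Hb).
    exact (derivatives_bounded_plus M _ _ _ _ _ (Hs (S k)) IH Hb).
Qed.

(** [psi] stands for [phi] or [- phi], which cosines do not distinguish, so that the slope may be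
    taken positive. *)
Lemma no_expanding_interval (M : nat -> R) (phi psi dpsi : R -> R) (a b c : R) :
  weight_sequence M -> nonanalytic M -> induces_endomorphism M phi ->
  0 < a -> a < b -> b < 1 -> 1 < c ->
  (forall x l, cos (l * psi x) = cos (l * phi x)) ->
  (forall x, a <= x <= b -> is_derive psi x (dpsi x)) ->
  (forall x, a <= x <= b -> c <= dpsi x) ->
  False.
Proof.
  intros HM Hna Hphi Ha Hab Hb Hc Hcos Hder Hexp.
  assert (HP := PI_RGT_0).
  set (c' := (1 + c) / 2); set (d := (1 + c') / 2).
  (* At frequency [l] the cosine has about [2 * eps * l] more oscillations than the spline of
     frequency [c' * l]; half of this surplus pays for Rolle, the other half, at least 3, for
     rounding. *)
  set (eps := (c - c') * (b - a) / (2 * PI)).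
  assert (Hc' : 1 < c' < c) by (unfold c'; lra).
  assert (Hd : 1 < d < c') by (unfold d; lra).
  assert (Heps : 0 < eps)
    by (apply Rdiv_lt_0_compat; [apply Rmult_lt_0_compat|]; lra).
  destruct (hump_sequence M phi c' d eps HM Hna Hphi ltac:(lra) ltac:(lra) Heps)
    as (l & al & B & m & Hl & Hal & Hdl & Hbig & Hstep & HB0).
  destruct (in_D_derivatives_bounded M
              (fun x => cos_series al l 0 (phi x)) HM) as (Binf & HBinf & Hinf).
  { apply (Hphi (fun y => RtoC (cos_series al l 0 y))).
    apply (cos_series_in_D M al l d 1 HM); try lra.
    - intros j; left; apply Hal.
    - intros j; left; apply Hl.
    - intros j i; rewrite Rmult_1_l; apply Hdl. }
  destruct HM as (Hpos & _ & _).
  (* The index [k] only has to exceed [Binf]. Its predecessor [k'] is kept because [sum_f_R0]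
     includes its last index. *)
  destruct (INR_unbounded Binf) as [k' Hk'].
  set (k := S k').
  assert (Hk : Binf < INR k) by (unfold k; rewrite S_INR; lra).
  assert (Hpart : derivatives_bounded M
            (fun x => sum_f_R0 (fun j => al j * cos (l j * phi x)) k') (B k)).
  { apply partial_sum_bounded; auto; intros j; destruct (Hal j) as (? & ? & _); auto. }
  (* [v] collects the derivatives of the composed series without its first [k] terms, bounded by
     [(Binf + B k) * M n]. *)
  destruct (derivatives_bounded_plus M _ _ (-1) _ _
              ltac:(rewrite Rabs_m1; lra) Hinf Hpart)
    as (v & V0 & V1 & V2).
  destruct (Hl k) as (Hl0 & Hl3 & Hlm); destruct (Hal k) as (Hal0 & _ & _).
  set (lk := l k) in *; set (ak := al k) in *.
  assert (Htail : forall j, al (S k + j)%nat <= ak / 8 * (/ 2) ^ j).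
  { induction j as [|j IH].
    - rewrite Nat.add_0_r, pow_O, Rmult_1_r; apply Hal.
    - rewrite Nat.add_succ_r.
      destruct (Hal (S k + j)%nat) as (H1 & _ & H2).
      simpl ((/ 2) ^ S j); lra. }
  (* The later terms sum to at most [2 * (ak / 8)], so where the cosine is 1 or -1 the size of [v 0]
     is at least [3 / 4 * ak], above the level [ak / 2] of the spline. *)
  assert (Hv0 : forall x, 0 < x < 1 ->
            Rabs (v 0%nat x - ak * cos (lk * phi x)) <= ak / 4).
  { intros x Hx; rewrite (V0 x Hx); unfold cos_series.
    set (u := fun j => al j * l j ^ 0 * cos (l j * phi x + INR 0 * (PI / 2))).
    assert (Eu : forall j, u j = al j * cos (l j * phi x)).
    { intros j; unfold u; simpl; rewrite Rmult_0_l, Rplus_0_r; ring. }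
    assert (Hu : forall j, Rabs (u j) <= al j).
    { intros j; rewrite Eu, Rabs_mult, Rabs_pos_eq by (left; apply Hal).
      assert (H1 := Rabs_cos_le (l j * phi x)); assert (H2 := proj1 (Hal j)); nra. }
    rewrite (Series_incr_n u (S k)); [|lia|].
    - rewrite <- (sum_eq u (fun j => al j * cos (l j * phi x)) k')
        by (intros; apply Eu).
      simpl (Init.Nat.pred (S k)); unfold k at 1; rewrite tech5, (Eu (S k')).
      fold k lk ak.
      replace (sum_f_R0 u k' + ak * cos (lk * phi x)
               + Series (fun j => u (S k + j)%nat) + -1 * sum_f_R0 u k'
               - ak * cos (lk * phi x))
        with (Series (fun j => u (S k + j)%nat)) by ring.
      replace (ak / 4) with (2 * (ak / 8)) by field.
      apply Series_le_half; intros j; eapply Rle_trans; [apply Hu | apply Htail].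
    - apply (ex_series_incr_n u (S k)).
      apply (ex_series_le_half _ (ak / 8)); intros j.
      eapply Rle_trans; [apply Hu | apply Htail]. }
  assert (Hmono : forall x y, a <= x -> x < y -> y <= b ->
            c * (y - x) <= psi y - psi x).
  { intros x y Hx Hxy Hy.
    destruct (MVT_cor2 psi dpsi x y Hxy) as [z [Hz1 Hz2]].
    - intros z Hz; apply is_derive_Reals, Hder; lra.
    - rewrite Hz1; apply Rmult_le_compat_r; [lra | apply Hexp; lra]. }
  set (D := lk * (b - a) / PI).
  assert (HD : eps * lk = (c - c') * D / 2) by (unfold eps, D; field; lra).
  assert (HD0 : 0 <= D) by (apply Rdiv_le_0_compat; [apply Rmult_le_pos|]; lra).
  (* Then [N > c * D - 2], and [c * D = c' * D + 2 * (eps * lk)] with [Hl3] and [Hlm] leaves room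
     for [c' * D + m k + 2]. *)
  destruct (nfloor_ex (c * D - 1)) as [N [HN1 HN2]].
  { nra. }
  destruct (cos_alternation_points (fun x => lk * psi x) a b N Hab)
    as (y & s & Hy & Hs).
  { intros x Hx; apply (continuity_pt_scal psi).
    apply (is_derive_continuity_pt psi x (dpsi x)), Hder, Hx. }
  { intros x y Hx Hxy Hy'; specialize (Hmono x y Hx Hxy Hy').
    apply Rmult_lt_compat_l; nra. }
  { specialize (Hmono a b ltac:(lra) Hab ltac:(lra)).
    apply Rle_trans with (PI * (c * D)); [apply Rmult_le_compat_l; lra|].
    replace (PI * (c * D)) with (lk * (c * (b - a))) by (unfold D; field; lra).
    rewrite <- Rmult_minus_distr_l; apply Rmult_le_compat_l; lra. }
  rewrite S_INR in Hlm.
  destruct (oscillation_derivative_bound v a b (c' * lk) (ak / 2) (m k) N s y)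
    as (x & Hx & Hlow).
  - intros i x Hx; apply V1; lra.
  - lra.
  - apply Rmult_lt_0_compat; lra.
  - lra.
  - exact Hy.
  - intros i Hi.
    assert (Hyi := proj1 Hy i ltac:(lia)).
    specialize (Hv0 (y i) ltac:(lra)); specialize (Hs i Hi).
    cbv beta in Hs; rewrite Hcos in Hs.
    assert (Hsg := pow_1_abs (i + s)).
    replace ((-1) ^ (i + s) * v 0%nat (y i))
      with (ak * ((-1) ^ (i + s) * cos (lk * phi (y i)))
            + (-1) ^ (i + s) * (v 0%nat (y i) - ak * cos (lk * phi (y i))))
      by ring.
    rewrite Hs.
    assert (Habs : Rabs ((-1) ^ (i + s)
                     * (v 0%nat (y i) - ak * cos (lk * phi (y i)))) <= ak / 4)
      by (rewrite Rabs_mult, Hsg; lra).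
    apply Rabs_le_between in Habs; lra.
  - replace (c' * lk * (b - a) / PI) with (c' * D) by (unfold D; field; lra).
    lra.
  (* The lower bound [ak / 4 * (c' * lk) ^ S (m k)] is at least [(INR k + B k) * M (S (m k))], which
     explains the 4 in [Hbig]; the upper bound has [Binf < INR k] instead. *)
  - specialize (V2 (S (m k)) x ltac:(lra)).
    specialize (Hbig k); fold lk ak in Hbig.
    assert (Hp := Hpos (S (m k))).
    assert (4 * (INR k + B k) * M (S (m k)) <= 4 * (Binf + B k) * M (S (m k)))
      by lra.
    nra.
Qed.

(** As [x] may be an endpoint, the interval is placed beside it, away from the nearer end of [0,1];
    it thus lies where ordinary derivatives exist. *)
Lemma interval_near (f : R -> R) (x eta : R) :
  continuity (fun x => f (clamp x)) -> I01 x -> 0 < eta ->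
  exists a b, 0 < a /\ a < b /\ b < 1 /\
    forall y, a <= y <= b -> Rabs (f y - f x) < eta.
Proof.
  intros Hc Hx Heta.
  destruct (Hc x eta Heta) as (del & Hdel & H).
  set (r := Rmin del (/ 2) / 2).
  assert (Hr : 0 < r) by (apply Rdiv_lt_0_compat; [apply Rmin_pos|]; lra).
  assert (R1 := Rmin_l del (/ 2)); assert (R2 := Rmin_r del (/ 2)).
  assert (Hnear : forall y, I01 y -> y <> x -> Rabs (y - x) <= r ->
            Rabs (f y - f x) < eta).
  { intros y Hy Hne Hyx.
    rewrite <- (clamp_id x Hx) at 1; rewrite <- (clamp_id y Hy).
    apply (H y); split; [split; [exact I | auto]|].
    apply Rle_lt_trans with r; [exact Hyx | unfold r; lra]. }
  destruct Hx as [Hx0 Hx1].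
  destruct (Rle_dec x (/ 2)) as [Hh|Hh].
  - exists (x + r / 2), (x + r); repeat split; try (unfold r in *; lra).
    intros y Hy; apply Hnear.
    + split; unfold r in *; lra.
    + lra.
    + apply Rabs_le; lra.
  - exists (x - r), (x - r / 2); repeat split; try (unfold r in *; lra).
    intros y Hy; apply Hnear.
    + split; unfold r in *; lra.
    + lra.
    + apply Rabs_le; lra.
Qed.

Theorem theorem1p2 :
  forall (M : nat -> R) (phi : R -> R),
    weight_sequence M ->
    nonanalytic M ->
    maps_I01 phi ->
    induces_endomorphism M phi ->
    exists dphi : R -> C,
      is_derive01 (fun x => RtoC (phi x)) dphi /\
      Rbar_le (supnorm01 dphi) 1.
Proof.
  intros M phi HM Hna _ Hphi.
  destruct (Hphi _ (in_D_id M)) as (g & [Hg0 Hg] & _).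
  assert (H0 := proj1 (proj1 (is_derive01_components _ _) (Hg 0%nat))).
  assert (H1 := proj1 (proj1 (is_derive01_components _ _) (Hg 1%nat))).
  set (dp := fun x => fst (g 1%nat x)) in *.
  assert (Hd : real_derive01 phi dp).
  { intros x Hx eps Heps; destruct (H0 x Hx eps Heps) as (del & Hdel & B).
    exists del; split; [exact Hdel|]; intros y Hy Hyx.
    specialize (B y Hy Hyx); rewrite (Hg0 x Hx), (Hg0 y Hy) in B; exact B. }
  exists (fun x => RtoC (dp x)); split; [apply is_derive01_RtoC, Hd|].
  apply Lub_Rbar_correct; intros r (x & Hx & ->); simpl.
  rewrite Cmod_R; apply Rnot_lt_le; intros Hgt.
  (* Halfway between 1 and [Rabs (dp x)]: near [x] the derivative keeps its sign and a size above
     [c > 1]. *)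
  set (c := (1 + Rabs (dp x)) / 2).
  destruct (interval_near dp x (Rabs (dp x) - c)) as (a & b & Ha & Hab & Hb & Hnear);
    [eapply real_derive01_continuity, H1 | exact Hx | unfold c; lra |].
  assert (Hder : forall y, a <= y <= b -> is_derive phi y (dp y))
    by (intros y Hy; apply is_derive_of_real_derive01; [exact Hd | lra]).
  destruct (Rle_dec 0 (dp x)) as [Hs|Hs].
  - assert (E := Rabs_pos_eq _ (Hs : 0 <= dp x)).
    apply (no_expanding_interval M phi phi dp a b c); auto.
    + unfold c; lra.
    + intros y Hy; specialize (Hnear y Hy); apply Rabs_lt_between in Hnear; lra.
  - assert (E := Rabs_left (dp x) ltac:(lra)).
    apply (no_expanding_interval M phi (fun y => - phi y) (fun y => - dp y) a b c);
      auto.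
    + unfold c; lra.
    + intros y l; rewrite <- cos_neg; f_equal; ring.
    + intros y Hy; apply (is_derive_opp (K := R_AbsRing) (V := R_NormedModule) phi).
      apply Hder, Hy.
    + intros y Hy; specialize (Hnear y Hy); apply Rabs_lt_between in Hnear; lra.
Qed.
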